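(* Let $s\in(0,1)$ and $p>1$ be such that $sp=1$. There exists $\alpha_*=\alpha_*(s)>0$ such that for all $\alpha\in[0,\alpha_* )$, $$\sup_{u\in W^{s,p}(\mathbb{R}),\ \|u\|_{W^{s,p}(\mathbb{R})}\le 1}\ \int_{\mathbb{R}}\Phi\!\left(\alpha|u|^{\frac{1}{1-s}}\right)dx<\infty .$$ Moreover, this supremum is equal to $+\infty$ for every $\alpha\in(\alpha^*,+\infty)$, where $$\alpha^*=\alpha^*(s):=\gamma_s^{\frac{s}{1-s}},\qquad \gamma_s:=8\,\Gamma(p+1)\sum_{k=0}^\infty\frac{1}{(1+2k)^p}.$$
   Context: Let $s\in(0,1)$, $p>1$ with $sp=1$. For a real-valued measurable $u$ on $\mathbb{R}$, the Gagliardo seminorm is $$[u]_{W^{s,p}(\mathbb{R})}:=\left(\int_{\mathbb{R}}\int_{\mathbb{R}}\frac{|u(x)-u(y)|^p}{|x-y|^2}\,dx\,dy\right)^{1/p},$$ the Sobolev-Slobodeckij space is $W^{s,p}(\mathbb{R}):=\{u\in L^p(\mathbb{R}) : [u]_{W^{s,p}(\mathbb{R})}<+\infty\}$, and its norm is $\|u\|_{W^{s,p}(\mathbb{R})}:=\left(\|u\|_{L^p(\mathbb{R})}^p+[u]_{W^{s,p}(\mathbb{R})}^p\right)^{1/p}$. The function $\Phi$ is $$\Phi(t):=e^t-\sum_{k=0}^{\lceil p-2\rceil}\frac{t^k}{k!},$$ where $\lceil p-2\rceil$ is the smallest integer greater than or equal to $p-2$. $\Gamma$ is the Euler Gamma function.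 *)

(* Defs.v *)
From mathcomp Require Import all_boot all_order all_algebra.
From mathcomp Require Import all_classical all_reals all_analysis.

Set Implicit Arguments.
Unset Strict Implicit.
Unset Printing Implicit Defensive.
Import Order.TTheory GRing.Theory Num.Theory.
Import numFieldNormedType.Exports.
Local Open Scope classical_set_scope.
Local Open Scope ring_scope.

(* Meaningful for z > 0, where the integral converges. *)
Definition Gamma {R : realType} (z : R) : R :=
  \int[@lebesgue_measure R]_(t in `]0, +oo[) (t `^ (z - 1) * expR (- t)).

(* For p > 1, p - 2 > -1, so the ceiling is a nonnegative integer and the
   absolute value, used only to get an index in nat, does not change it. *)
Definition Phi {R : realType} (p t : R) : R :=
  expR t - \sum_(0 <= k < `|Num.ceil (p - 2)|%N.+1) t ^+ k / k`!%:R.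

(* The kernel exponent 1 + s p equals 2 since s p = 1, hence only p occurs.
   On the diagonal x = y, a null set, the integrand is 0 (0 / 0 = 0). *)
Definition gagliardo {R : realType} (p : R) (u : R -> R) : \bar R :=
  ((\int[@lebesgue_measure R]_y \int[@lebesgue_measure R]_x
      (`|u x - u y| `^ p / `|x - y| ^+ 2)%:E) `^ p^-1)%E.

(* Borel representatives: every class of Lebesgue measurable functions modulo
   a.e. equality contains one, and all the integrals depend only on the class. *)
Definition Wsp {R : realType} (p : R) : set (R -> R) :=
  [set u : R -> R | u \in Lfun (@lebesgue_measure R) p%:E /\
                    (gagliardo p u < +oo)%E].

Definition Wsp_norm {R : realType} (p : R) (u : R -> R) : \bar R :=
  (('N[@lebesgue_measure R]_p%:E [EFin \o u] `^ p
     + gagliardo p u `^ p) `^ p^-1)%E.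

Definition MT_sup {R : realType} (s p alpha : R) : \bar R :=
  ereal_sup [set (\int[@lebesgue_measure R]_x
                   (Phi p (alpha * `|u x| `^ (1 - s)^-1))%:E)%E
            | u in [set u | Wsp p u /\ (Wsp_norm p u <= 1)%E]].

Definition gamma_s {R : realType} (p : R) : R :=
  8 * Gamma (p + 1) * limn (series (fun k => ((1 + 2 * k%:R) `^ p)^-1)).

Definition alpha_star {R : realType} (s p : R) : R :=
  gamma_s p `^ (s / (1 - s)).

(* Main.v *)
From HB Require Import structures.
Require Import Defs.
From mathcomp Require Import all_boot all_order all_algebra.
From mathcomp Require Import all_classical all_reals all_analysis.
From mathcomp Require Import measurable_realfun ring lra.

(** Write p' = p / (p - 1) = (1 - s)^-1, and let [u]^p denote the double integral
    of |u x - u y|^p / |x - y|^2.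

    Small exponents.  Let l n be the value of the decreasing rearrangement of
    |u| at 2^-n, so that {|u| > l n} has measure at most 2^-n and
    {|u| >= l n} has measure at least 2^-n.  If |u y| >= l (n+1), the points x
    with |u x| <= l n fill at least half of the interval of radius 2^-n around
    y; after integration over such y, they contribute to [u]^p at least a
    constant times (l (n+1) - l n)^p.  As t^p is superadditive, the contributions
    of all n add up ([gagliardo_level_gaps]), so the p-th powers of the gaps of l
    have a bounded sum, and l n <= C n^(1/p') when the norm of u is at most 1.
    This is an exponential decay of the measure of {|u| >= t} in t^p'
    ([measure_superlevel_decay]); it is uniform in u, and integrating Phi over
    the shells between consecutive levels gives [MT_sup_lty].

    Large exponents.  The test functions are the truncated logarithms
    g x = min (max (- ln |x|) 0) L, suitably scaled.  Their seminorm satisfies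
    [g]^p <= gamma_s L for every L >= 0 ([gagliardo_logclamp_le]), with no error
    term.  Indeed, g is even, so the double integral folds onto x, y > 0, and by
    symmetry onto 0 < x < y.  The substitution x = r y separates the
    variables: g changes by at most - ln r under the dilation by r, and the
    integral of g (r y) - g y against dy / y equals L (- ln r).  There
    remains, up to the factor 4 L, the integral over ]0, 1[ of (- ln r)^p against
    (1 - r)^-2 + (1 + r)^-2 = 2 sum_k (2 k + 1) r^(2 k), and the substitution
    r = exp (- t) evaluates it term by term to
    2 Gamma (p + 1) sum_k (2 k + 1)^-p.

    The L^p norm of g stays bounded in L while g = L for 0 < |x| < exp (- L).
    After normalisation, Phi takes there a value close to exp (kappa L), where
    kappa > 1 as soon as alpha > gamma_s^(s / (1 - s)), and the integral of Phi
    is unbounded as L grows ([MT_sup_pinfty]). *)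

Set Implicit Arguments.
Unset Strict Implicit.
Unset Printing Implicit Defensive.
Import Order.TTheory GRing.Theory Num.Theory.
Import numFieldNormedType.Exports.
Local Open Scope classical_set_scope.
Local Open Scope ring_scope.

(** * Integrals, measurability and series *)

(** Only the simple functions below a nonnegative function enter its integral, so
    monotonicity needs no measurability.  The inner integrals of the seminorm can
    thus be bounded from above and from below without showing first that they
    are measurable in the outer variable. *)
Lemma ge0_le_integral_nomeas d (T : measurableType d) (R : realType)
    (mu : {measure set T -> \bar R}) (D : set T) (f g : T -> \bar R) :
  (forall x, D x -> 0 <= f x)%E -> (forall x, D x -> f x <= g x)%E ->
  (\int[mu]_(x in D) f x <= \int[mu]_(x in D) g x)%E.
Proof.
move=> f0 fg; rewrite !ge0_integralE//; last first.
  by move=> x Dx; exact: le_trans (f0 _ Dx) (fg _ Dx).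
apply: le_ereal_sup => _ [h hf <-]; exists h => // x.
apply: le_trans (hf x) _; rewrite /patch; case: ifPn => // /set_mem.
exact: fg.
Qed.

Lemma ge0_integral_cst_indic d (T : measurableType d) (R : realType)
    (mu : {measure set T -> \bar R}) (A : set T) (c : R) : 0 <= c ->
  measurable A -> (\int[mu]_x (c * \1_A x)%:E = c%:E * mu A)%E.
Proof.
move=> c0 mA; under eq_integral do rewrite EFinM.
rewrite ge0_integralZl_EFin//; first by rewrite integral_indic// setIT.
by apply/measurable_EFinP.
Qed.

Lemma measurable_funV d (T : measurableType d) (R : realType) (D : set T)
    (f : T -> R) : measurable_fun D f -> measurable_fun D (fun x => (f x)^-1).
Proof.
move=> mf.
(* This writes the inverse with a real power, which is known to be measurable;
   the square makes the base nonnegative. *)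
rewrite (_ : (fun x => _) = fun x => f x * (f x ^+ 2) `^ (-1)); last first.
  apply/funext => x; rewrite powR_inv1 ?sqr_ge0//.
  have [->|f0] := eqVneq (f x) 0; first by rewrite invr0 mul0r.
  by rewrite expr2 invfM mulrA divff// mul1r.
apply: measurable_funM => //.
apply: (@measurableT_comp _ _ _ _ _ _ (fun x => powR x (-1))).
  exact: measurable_powR.
exact: measurable_funX.
Qed.

Lemma measurable_fun_powR d (T : measurableType d) (R : realType) (D : set T)
    (f : T -> R) (p : R) :
  measurable_fun D f -> measurable_fun D (fun x => f x `^ p).
Proof.
by move=> mf; apply: (measurableT_comp (@measurable_powR R p) mf).
Qed.

Lemma measurable_gtr d (T : measurableType d) (R : realType) (f : T -> R) t :
  measurable_fun setT f -> measurable [set x | t < f x].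
Proof.
move=> mf; rewrite (_ : [set x | t < f x] = f @^-1` `]t, +oo[); last first.
  by apply/seteqP; split => x /=; rewrite in_itv/= andbT.
by rewrite -[X in measurable X]setTI; exact: mf.
Qed.

Lemma measurable_ger d (T : measurableType d) (R : realType) (f : T -> R) t :
  measurable_fun setT f -> measurable [set x | t <= f x].
Proof.
move=> mf; rewrite (_ : [set x | t <= f x] = f @^-1` `[t, +oo[); last first.
  by apply/seteqP; split => x /=; rewrite in_itv/= andbT.
by rewrite -[X in measurable X]setTI; exact: mf.
Qed.

Lemma measurable_ler d (T : measurableType d) (R : realType) (f : T -> R) t :
  measurable_fun setT f -> measurable [set x | f x <= t].
Proof.
move=> mf; rewrite (_ : [set x | f x <= t] = f @^-1` `]-oo, t]); last first.
  by apply/seteqP; split => x /=; rewrite in_itv.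
by rewrite -[X in measurable X]setTI; exact: mf.
Qed.

Lemma measurable_comp_fst (R : realType) (g : R -> R) : measurable_fun setT g ->
  measurable_fun setT (fun z : measurableTypeR R * measurableTypeR R => g z.1).
Proof. by move=> mg; apply: measurableT_comp mg _; exact: measurable_fst. Qed.

Lemma measurable_comp_snd (R : realType) (g : R -> R) : measurable_fun setT g ->
  measurable_fun setT (fun z : measurableTypeR R * measurableTypeR R => g z.2).
Proof. by move=> mg; apply: measurableT_comp mg _; exact: measurable_snd. Qed.

Lemma exists_invSn_lt (R : realType) (d : R) : 0 < d -> exists n, n.+1%:R^-1 < d.
Proof.
move=> d0; exists (Num.trunc d^-1).
by rewrite invf_plt ?posrE// truncnS_gt.
Qed.

Lemma nneseries_geometric_lty (R : realType) (a z : R) : 0 <= a -> 0 <= z < 1 ->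
  (\sum_(0 <= n <oo) (a * z ^+ n)%:E < +oo)%E.
Proof.
move=> a0 /andP[z0 z1]; apply: (@le_lt_trans _ _ (a / (1 - z))%:E); last first.
  by rewrite ltry.
apply: lime_le; first by apply: is_cvg_nneseries => n _ _; rewrite lee_fin mulr_ge0 ?exprn_ge0.
apply: nearW => n; rewrite sumEFin lee_fin.
have := geometric_seriesE a (_ : z != 1).
rewrite lt_eqF// => /(_ isT)/(congr1 (fun f => f n)); rewrite /series/= => ->.
apply: ler_wpM2r; first by rewrite invr_ge0 subr_ge0 ltW.
by rewrite ler_piMr// gerBl exprn_ge0.
Qed.

Lemma nneseries_EFin_cvg (R : realType) (u : nat -> R) : cvgn (series u) ->
  (\sum_(0 <= k <oo) (u k)%:E)%E = (limn (series u))%:E.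
Proof.
move=> cu; rewrite -EFin_lim//; apply: congr_lim; apply/funext => n /=.
by rewrite sumEFin.
Qed.

(** * The decreasing rearrangement *)

Definition rearrangement d (T : measurableType d) (R : realType)
    (mu : {measure set T -> \bar R}) (f : T -> R) (m : R) : R :=
  inf [set t | 0 <= t /\ (mu [set x | (t < f x)%R] <= m%:E)%E].

Lemma rearrangement_ge0 d (T : measurableType d) (R : realType)
    (mu : {measure set T -> \bar R}) (f : T -> R) (m t0 : R) : 0 <= t0 ->
  (mu [set x | (t0 < f x)%R] <= m%:E)%E -> 0 <= rearrangement mu f m.
Proof.
by move=> t00 mt0; apply: lb_le_inf; [exists t0|move=> x []].
Qed.

Lemma rearrangement_le d (T : measurableType d) (R : realType)
    (mu : {measure set T -> \bar R}) (f : T -> R) (m t : R) : 0 <= t ->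
  (mu [set x | (t < f x)%R] <= m%:E)%E -> rearrangement mu f m <= t.
Proof.
by move=> t0 mt; apply: ge_inf; [exists 0 => x []|split].
Qed.

(** The infimum defining the rearrangement is attained, because {f > t}
    increases to {f > l} as t decreases to l. *)
Lemma measure_gt_rearrangement d (T : measurableType d) (R : realType)
    (mu : {measure set T -> \bar R}) (f : T -> R) (m t0 : R) :
  measurable_fun setT f -> 0 <= t0 ->
  (mu [set x | (t0 < f x)%R] <= m%:E)%E ->
  (mu [set x | (rearrangement mu f m < f x)%R] <= m%:E)%E.
Proof.
move=> mf t00 mt0; set l := rearrangement mu f m.
pose F n := [set x | l + n.+1%:R^-1 < f x].
have mF n : measurable (F n) by exact: measurable_gtr.
have FE : [set x | l < f x] = \bigcup_n F n.
  apply/seteqP; split => x /=; last first.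
    by move=> [n _]; apply: le_lt_trans; rewrite lerDl invr_ge0.
  move=> lfx; have d0 : 0 < f x - l by lra.
  have [n nd] := exists_invSn_lt d0.
  by exists n => //; rewrite /F/= -ltrBrDl.
rewrite FE.
have mUF : measurable (\bigcup_n F n) by exact: bigcup_measurable.
have ndF : {homo F : n m / (n <= m)%N >-> (n <= m)%O}.
  move=> i j ij; apply/subsetPset => x; apply: le_lt_trans.
  by rewrite lerD2l lef_pV2 ?posrE// ler_nat.
have Fcvg := nondecreasing_cvg_mu (mu := mu) mF mUF ndF.
rewrite -(cvg_lim _ Fcvg)//; apply: lime_le.
  by apply/cvg_ex; eexists; exact: Fcvg.
apply: nearW => n /=.
have hE : has_inf [set t | 0 <= t /\ (mu [set x | (t < f x)%R] <= m%:E)%E].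
  by split; [exists t0|exists 0 => x []].
have n0 : 0 < n.+1%:R^-1 :> R by rewrite invr_gt0.
have [e [e0 me] el] := inf_adherent n0 hE.
apply: le_trans me; apply: le_measure; rewrite ?inE//.
  exact: measurable_gtr.
by move=> x /=; apply: lt_trans.
Qed.

(** The sets {f > t} decrease to {f >= l} as t increases to l; continuity of
    the measure from above is what requires them to have finite measure. *)
Lemma measure_ge_rearrangement d (T : measurableType d) (R : realType)
    (mu : {measure set T -> \bar R}) (f : T -> R) (m : R) :
  measurable_fun setT f ->
  (forall t, 0 < t -> (mu [set x | (t < f x)%R] < +oo)%E) ->
  0 < rearrangement mu f m ->
  (m%:E <= mu [set x | (rearrangement mu f m <= f x)%R])%E.
Proof.
move=> mf fin; set l := rearrangement mu f m => l0.
pose F n := [set x | l * (1 - n.+2%:R^-1) < f x].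
have mF n : measurable (F n) by exact: measurable_gtr.
have n1 n : n.+2%:R^-1 < 1 :> R by rewrite invf_lt1 ?ltr1n.
have n0 n : 0 < n.+2%:R^-1 :> R by rewrite invr_gt0.
have FE : [set x | l <= f x] = \bigcap_n F n.
  apply/seteqP; split => x /= => [lfx n _|H].
    apply: lt_le_trans lfx; rewrite -[ltRHS]mulr1 ltr_pM2l// ltrBlDr ltrDl//.
  rewrite leNgt; apply/negP => fxl.
  have d0 : 0 < (l - f x) / l by rewrite divr_gt0// subr_gt0.
  have [n nd] := exists_invSn_lt d0.
  have := H n I; rewrite /F/=; apply/negP; rewrite -leNgt.
  have : n.+2%:R^-1 <= (l - f x) / l.
    by apply: le_trans (ltW nd); rewrite lef_pV2 ?posrE// ler_nat.
  by rewrite ler_pdivlMr// => ?; rewrite mulrBr mulr1 lerBrDl -lerBrDr mulrC.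
rewrite FE.
have mUF : measurable (\bigcap_n F n) by exact: bigcapT_measurable.
have ndF : {homo F : n m / (n <= m)%N >-> (m <= n)%O}.
  move=> i j ij; apply/subsetPset => x; apply: le_lt_trans.
  by rewrite ler_pM2l// lerD2l lerN2 lef_pV2 ?posrE// ler_nat.
have l1 n : 0 < l * (1 - n.+2%:R^-1) by rewrite mulr_gt0// subr_gt0.
have F0 : (mu (F 0%N) < +oo)%E by exact: fin.
have Fcvg := nonincreasing_cvg_mu F0 mF mUF ndF.
rewrite -(cvg_lim _ Fcvg)//; apply: lime_ge.
  by apply/cvg_ex; eexists; exact: Fcvg.
apply: nearW => n /=; rewrite leNgt; apply/negP => Fm.
have : l <= l * (1 - n.+2%:R^-1).
  by apply: rearrangement_le; [exact: ltW|exact: ltW].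
apply/negP; rewrite -ltNge -[ltRHS]mulr1 ltr_pM2l// ltrBlDr ltrDl//.
Qed.

(** * Exponential decay of superlevel sets *)

(** Write a^p = a a^(p-1) and compare a^(p-1) with (a + b)^(p-1). *)
Lemma powR_superadditive (R : realType) (p a b : R) : 1 <= p ->
  0 <= a -> 0 <= b -> a `^ p + b `^ p <= (a + b) `^ p.
Proof.
move=> p1 a0 b0; have p0 : 0 < p by lra.
have ab0 : 0 <= a + b by lra.
rewrite -!(mulr_powRB1 _ p0)// mulrDl.
by apply: lerD; apply: ler_wpM2l => //; apply: ge0_ler_powR; rewrite ?nnegrE//; lra.
Qed.

(** The gaps of l that lie between Y and X do not overlap, so their lengths add
    up to at most X - Y, and superadditivity transfers this to the p-th powers.
    Truncating X at l n is what makes the induction on n go through. *)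
Lemma sum_gaps_powR_le (R : realType) (p : R) (l : nat -> R) (X Y : R) n : 1 <= p ->
  nondecreasing_seq l ->
  \sum_(i < n) (l i.+1 - l i) `^ p * (l i.+1 <= X)%R%:R * (Y <= l i)%R%:R <=
  Num.max (Num.min X (l n) - Y) 0 `^ p.
Proof.
move=> p1 ndl; elim: n => [|n IH]; first by rewrite big_ord0 powR_ge0.
rewrite big_ord_recr /=; have ln : l n <= l n.+1 by exact: ndl.
have m0 : 0 <= Num.max (Num.min X (l n) - Y) 0 by rewrite le_max lexx orbT.
have mono : Num.max (Num.min X (l n) - Y) 0 <= Num.max (Num.min X (l n.+1) - Y) 0.
  rewrite ge_max !le_max lexx orbT andbT; apply/orP; left.
  by rewrite lerD2r le_min ge_min lexx /= ge_min ln orbT.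
have mono' : Num.max (Num.min X (l n) - Y) 0 `^ p <=
             Num.max (Num.min X (l n.+1) - Y) 0 `^ p.
  by apply: (ge0_ler_powR _ _ _ mono); rewrite ?nnegrE ?le_max ?lexx ?orbT//; lra.
case lX: (l n.+1 <= X); last first.
  by rewrite mulr0 mul0r addr0 (le_trans IH).
case Yl: (Y <= l n); last by rewrite mulr0 addr0 (le_trans IH).
rewrite !mulr1; apply: (le_trans (lerD IH (lexx _))).
rewrite (min_r (le_trans ln lX)) (min_r lX) !max_l; [|lra|lra].
apply: le_trans (powR_superadditive p1 _ _) _; [lra|lra|].
by rewrite addrAC addrCA subrr addr0.
Qed.

(** The interval of radius b around y has length 2 b, of which at most b lies
    outside of S.  Since 1/|x - y|^2 >= b^-2 on that interval, the left-hand side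
    bounds from below the integral of 1/|x - y|^2 over S, without evaluating any
    singular integral. *)
Lemma inv_sqr_le_measure_ball (R : realType) (S : set R) (y b : R) :
  measurable S -> 0 < b -> (@lebesgue_measure R (~` S) <= b%:E)%E ->
  ((b^-1)%:E <= (b ^- 2)%:E * @lebesgue_measure R (S `&` `[(y - b)%R, (y + b)%R]))%E.
Proof.
move=> mS b0 Sb; set I := `[y - b, y + b]%classic.
have mI : measurable I by exact: measurable_itv.
have IE : lebesgue_measure I = (b + b)%:E.
  rewrite /I lebesgue_measure_itv/= lte_fin ifT; last lra.
  by rewrite -EFinB; congr EFin; lra.
have : (b%:E <= @lebesgue_measure R (S `&` I))%E.
  rewrite -(leeD2rE _ _ (_ : b%:E \is a fin_num))// -EFinD -IE.
  apply: le_trans (leeD2l _ Sb); apply: le_trans (measureU2 _ _ _).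
  - apply: le_measure; rewrite ?inE//.
      by apply: measurableU; [exact: measurableI|exact: measurableC].
    by move=> x Ix; have [Sx|Sx] := pselect (S x); [left|right].
  - exact: measurableI.
  - exact: measurableC.
move=> /(lee_wpmul2l (_ : (0 <= (b ^- 2)%:E)%E)) H.
apply: le_trans (H _); last by rewrite lee_fin invr_ge0 exprn_ge0// ltW.
by rewrite -EFinM lee_fin -exprVn expr2 -mulrA mulVf ?mulr1// gt_eqF.
Qed.

(** For fixed y, the integrand dominates the sum over the gaps below |u y| of
    simple functions of x, supported where |u x| <= l i and |x - y| <= m i.
    Integrating first in x gives a weight 1 / m i for each gap, and then in y
    the measure of {|u| >= l i.+1}. *)
Lemma gagliardo_level_gaps (R : realType) (p : R) (u : R -> R) (l m : nat -> R) n :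
  1 <= p -> measurable_fun setT u -> nondecreasing_seq l ->
  (forall i, 0 < m i) ->
  (forall i, @lebesgue_measure R [set x | (l i < `|u x|)%R] <= (m i)%:E)%E ->
  (forall i, (m i.+1)%:E <= @lebesgue_measure R [set x | (l i.+1 <= `|u x|)%R])%E ->
  ((\sum_(i < n) (l i.+1 - l i) `^ p * (m i.+1 / m i))%:E <=
   \int[@lebesgue_measure R]_y \int[@lebesgue_measure R]_x
     (`|u x - u y| `^ p / `|x - y| ^+ 2)%:E)%E.
Proof.
move=> p1 mesu ndl m0 lm ml.
have mnu : measurable_fun setT (fun x => `|u x|) by exact: measurableT_comp.
pose S i := [set x | `|u x| <= l i].
have mS i : measurable (S i) by exact: measurable_ler.
pose E i := [set x | l i.+1 <= `|u x|].
have mE i : measurable (E i) by exact: measurable_ger.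
pose G (i : 'I_n) (y : R) : \bar R :=
  (((l i.+1 - l i) `^ p / m i) * \1_(E i) y)%:E.
have c0 (i : 'I_n) : 0 <= (l i.+1 - l i) `^ p / m i.
  by rewrite divr_ge0 ?powR_ge0// ltW.
have G0 i y : (0 <= G i y)%E by rewrite lee_fin mulr_ge0.
have mG i : measurable_fun setT (G i).
  by apply/measurable_EFinP; apply: measurable_funM.
apply: (@le_trans _ _ (\int[@lebesgue_measure R]_y (\sum_(i < n) G i y))%E).
  rewrite ge0_integral_sum// -sumEFin; apply: lee_sum => i _.
  rewrite /G ge0_integral_cst_indic; [|exact: c0|exact: mE].
  rewrite [X in ((_ * X)%:E <= _)%E]mulrC mulrA EFinM.
  by apply: lee_wpmul2l; [rewrite lee_fin|exact: ml].
apply: ge0_le_integral_nomeas => y _; first by apply: sume_ge0.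
pose H (i : 'I_n) (x : R) : \bar R :=
  ((l i.+1 - l i) `^ p * \1_(E i) y * (m i) ^- 2 *
     \1_(S i `&` `[y - m i, y + m i]) x)%:E.
have mSI (i : 'I_n) : measurable (S i `&` `[y - m i, y + m i]).
  exact: measurableI.
have mH i : measurable_fun setT (H i).
  by apply/measurable_EFinP; apply: measurable_funM.
have d0 (i : 'I_n) : 0 <= (l i.+1 - l i) `^ p * \1_(E i) y.
  by rewrite mulr_ge0// powR_ge0.
have e0 (i : 'I_n) : 0 <= (l i.+1 - l i) `^ p * \1_(E i) y * (m i) ^- 2.
  by rewrite mulr_ge0// invr_ge0 exprn_ge0// ltW.
have H0 i x : (0 <= H i x)%E.
  by rewrite lee_fin mulr_ge0.
apply: (@le_trans _ _ (\int[@lebesgue_measure R]_x (\sum_(i < n) H i x))%E).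
  rewrite ge0_integral_sum//; apply: lee_sum => i _.
  rewrite /H ge0_integral_cst_indic; [|exact: e0|exact: mSI].
  rewrite EFinM -muleA.
  rewrite /G -mulrA [X in (_ * X)%:E]mulrC mulrA EFinM.
  apply: lee_wpmul2l; first by rewrite lee_fin.
  apply: inv_sqr_le_measure_ball => //.
  rewrite (_ : ~` S i = [set x | l i < `|u x|])//.
  by apply/seteqP; split => x /=; rewrite ltNge => /negP.
apply: ge0_le_integral_nomeas => x _; first by apply: sume_ge0.
rewrite /H sumEFin lee_fin.
(* On the diagonal the integrand is 0, and the left-hand side must vanish too:
   the two level conditions on u y then force l i.+1 = l i. *)
have [->|xy] := eqVneq x y.
  rewrite big1 ?mulr_ge0 ?powR_ge0 ?invr_ge0// => i _.
  rewrite !indicE; case: (boolP (_ \in S _ `&` _)) => [|_]; last by rewrite mulr0.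
  rewrite inE => -[/= Sy _].
  case: (boolP (_ \in E _)) => [|_]; last by rewrite mulr0 !mul0r.
  rewrite inE => /= Ey; rewrite (_ : l i.+1 - l i = 0) ?powR0 ?mul0r//; first lra.
  have := ndl i i.+1 (leqnSn i); have := le_trans Ey Sy; lra.
have xy0 : 0 < `|x - y| by rewrite normr_gt0 subr_eq0.
rewrite ler_pdivlMr ?exprn_gt0// mulr_suml.
apply: (@le_trans _ _ (\sum_(i < n) (l i.+1 - l i) `^ p *
    (l i.+1 <= `|u y|)%R%:R * (`|u x| <= l i)%R%:R)).
  apply: ler_sum => i _; rewrite !indicE.
  rewrite (_ : (y \in E i) = (l i.+1 <= `|u y|)); last by apply/idP/idP; rewrite inE.
  rewrite -!mulrA; apply: ler_wpM2l; first exact: powR_ge0.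
  apply: ler_wpM2l => //.
  case: (boolP (x \in _)) => [|_]; last by rewrite mul0r mulr0.
  rewrite inE => -[/= -> ]; rewrite in_itv/= mul1r => xi.
  rewrite mulrC ler_pdivrMr ?exprn_gt0// mul1r ler_sqr ?nnegrE//; last exact: ltW.
  rewrite ler_norml; apply/andP; split; lra.
apply: (le_trans (sum_gaps_powR_le _ _ _ p1 ndl)).
apply: ge0_ler_powR; rewrite ?nnegrE ?le_max ?lexx ?orbT//; first lra.
rewrite ge_max normr_ge0 andbT.
apply: (@le_trans _ _ (`|u y| - `|u x|)); first by rewrite lerD2r ge_min lexx.
by rewrite distrC; exact: lerB_dist.
Qed.

(** Chebyshev's inequality. *)
Lemma measure_gt_le_powR (R : realType) (p t : R) (u : R -> R) : 0 < p ->
  measurable_fun setT u ->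
  (\int[@lebesgue_measure R]_x (`|u x| `^ p)%:E <= 1)%E -> 0 < t ->
  (@lebesgue_measure R [set x | (t < `|u x|)%R] <= (t `^ (- p))%:E)%E.
Proof.
move=> p0 mesu I1 t0; have tp0 : 0 < t `^ p by exact: powR_gt0.
have mA : measurable [set x | t < `|u x|].
  by apply: measurable_gtr; exact: measurableT_comp.
rewrite powRN -[leLHS]mul1e -(mulVf (lt0r_neq0 tp0)) EFinM -muleA.
rewrite -[leRHS]mule1; apply: lee_wpmul2l; first by rewrite lee_fin invr_ge0 ltW.
apply: le_trans I1.
rewrite -(@ge0_integral_cst_indic _ _ _ (@lebesgue_measure R) _ _ (ltW tp0) mA).
apply: ge0_le_integral_nomeas => x _; rewrite lee_fin; first by rewrite mulr_ge0// ltW.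
rewrite indicE; case: (boolP (_ \in _)) => [|_]; last by rewrite mulr0 powR_ge0.
rewrite inE/= mulr1 => tu; apply: ge0_ler_powR; rewrite ?nnegrE//; lra.
Qed.

(** Either D <= tau, or D^p tau^(1-p) >= D.  Summed over n values of D and
    optimised in tau, this plays the role of the Hoelder inequality. *)
Lemma le_add_powR (R : realType) (p D tau : R) : 1 < p -> 0 <= D -> 0 < tau ->
  D <= tau + D `^ p * tau `^ (1 - p).
Proof.
move=> p1 D0 tau0; have [Dt|tD] := leP D tau.
  by rewrite (le_trans Dt)// lerDl mulr_ge0 ?powR_ge0.
have D1 : 0 < D by lra.
suff : D <= D `^ p * tau `^ (1 - p) by lra.
rewrite -(@mulr_powRB1 _ D p)//; last lra.
rewrite -mulrA ler_peMr// -(opprB p 1) powRN ler_pdivlMr ?powR_gt0// mul1r.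
apply: ge0_ler_powR; rewrite ?nnegrE//; lra.
Qed.

(** Take m i = 2^-i and let l i be the rearrangement of |u| at m i.  All the
    ratios m i.+1 / m i are 1/2, so the sum of the p-th powers of the gaps of l
    is at most 2, while l 0 <= 1 by Chebyshev.  Hence
    l n <= 1 + n tau + 2 tau^(1-p), which is at most 4 n^(1 - 1/p) for
    tau = n^(-1/p).  The constant 5 gives a strict inequality, as needed to
    include {|u| >= 5 n^(1 - 1/p)} in {|u| > l n}. *)
Lemma measure_superlevel_decay (R : realType) (p : R) (u : R -> R) (n : nat) :
  1 < p -> measurable_fun setT u ->
  (\int[@lebesgue_measure R]_x (`|u x| `^ p)%:E <= 1)%E ->
  (\int[@lebesgue_measure R]_y \int[@lebesgue_measure R]_x
     (`|u x - u y| `^ p / `|x - y| ^+ 2)%:E <= 1)%E -> (0 < n)%N ->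
  (@lebesgue_measure R [set x | (5 * n%:R `^ (1 - p^-1) <= `|u x|)%R] <=
     (2 ^- n)%:E)%E.
Proof.
move=> p1 mesu Np Gp n0; have p0 : 0 < p by lra.
have mf : measurable_fun setT (fun x => `|u x|) by exact: measurableT_comp.
pose m i : R := 2 ^- i.
have m0 i : 0 < m i by rewrite invr_gt0 exprn_gt0.
pose l i := rearrangement (@lebesgue_measure R) (fun x => `|u x|) (m i).
have cheb := @measure_gt_le_powR _ _ _ _ p0 mesu Np.
have attained i : exists2 t, 0 <= t &
    (@lebesgue_measure R [set x | (t < `|u x|)%R] <= (m i)%:E)%E.
  exists (m i `^ (- p^-1)); first exact: powR_ge0.
  apply: le_trans (cheb _ (powR_gt0 _ (m0 i))) _.
  by rewrite -powRrM mulrNN mulVf ?powRr1 ?lt0r_neq0// ltW.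
have lm i : (@lebesgue_measure R [set x | (l i < `|u x|)%R] <= (m i)%:E)%E.
  by have [t t0 mt] := attained i; exact: measure_gt_rearrangement mt.
have l0 i : 0 <= l i.
  by have [t t0 mt] := attained i; exact: rearrangement_ge0 mt.
have ml i : ((m i)%:E <= @lebesgue_measure R [set x | (l i <= `|u x|)%R])%E.
  (* If l i = 0, the set is the whole line. *)
  have := l0 i; rewrite le_eqVlt => /predU1P[li0|]; last first.
    apply: measure_ge_rearrangement => // t t0.
    by apply: le_lt_trans (cheb _ t0) _; rewrite ltry.
  rewrite (_ : [set x | _] = setT); first by rewrite -set_itvNyy lebesgue_measure_itv/= leey.
  by apply/seteqP; split => // x _ /=; rewrite -li0.
have ndl : nondecreasing_seq l.
  move=> i j ij; apply: rearrangement_le => //; apply: le_trans (lm j) _.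
  by rewrite lee_fin lef_pV2 ?posrE ?exprn_gt0// ler_weXn2l// ler1n.
have l01 : l 0%N <= 1.
  apply: rearrangement_le => //; apply: le_trans (cheb _ ltr01) _.
  by rewrite powR1 /m expr0 invr1.
have gaps : \sum_(i < n) (l i.+1 - l i) `^ p <= 2.
  have := gagliardo_level_gaps n (ltW p1) mesu ndl m0 lm (fun i => ml i.+1).
  move=> /le_trans/(_ Gp); rewrite lee_fin.
  rewrite (eq_bigr (fun i : 'I_n => (l i.+1 - l i) `^ p * 2^-1)); last first.
    move=> i _; congr (_ * _).
    by rewrite /m exprS invfM -mulrA divff ?mulr1// lt0r_neq0.
  by rewrite -mulr_suml; lra.
have nR : 0 < n%:R :> R by rewrite ltr0n.
have ln : l n < 5 * n%:R `^ (1 - p^-1).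
  have := telescope_sumr l (leq0n n); rewrite big_mkord => lE.
  pose tau : R := n%:R `^ (- p^-1).
  have tau0 : 0 < tau by exact: powR_gt0.
  have D0 i : 0 <= l i.+1 - l i by rewrite subr_ge0 ndl.
  have : \sum_(i < n) (l i.+1 - l i) <=
      \sum_(i < n) (tau + (l i.+1 - l i) `^ p * tau `^ (1 - p)).
    by apply: ler_sum => i _; exact: le_add_powR.
  rewrite lE big_split/= sumr_const card_ord -mulr_suml -[tau *+ n]mulr_natl.
  have -> : n%:R * tau = n%:R `^ (1 - p^-1).
    by rewrite powRD ?powRr1 ?ltW//; apply/implyP => _; exact: lt0r_neq0.
  have -> : tau `^ (1 - p) = n%:R `^ (1 - p^-1).
    by rewrite -powRrM; congr (_ `^ _); field; exact: lt0r_neq0.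
  have : 1 <= n%:R `^ (1 - p^-1) :> R.
    rewrite -[leLHS](powRr0 n%:R); apply: ler_powR; first by rewrite ler1n.
    by rewrite subr_ge0 invf_le1 ?ltW.
  have := gaps; set S := \sum_(i < n) _ `^ p; set N := n%:R `^ _; nra.
apply: le_trans (lm n); apply: le_measure; rewrite ?inE.
- exact: measurable_ger.
- exact: measurable_gtr.
by move=> x /=; exact: lt_le_trans.
Qed.

(** * The truncated exponential *)

Lemma exp_partial_sum_le (R : realType) (t : R) n : 0 <= t ->
  \sum_(0 <= k < n) t ^+ k / k`!%:R <= expR t.
Proof.
move=> t0; apply: (@nondecreasing_cvgn_le _ (series (exp_coeff t))).
  apply: nondecreasing_series => i _ _.
  by rewrite /exp_coeff/= divr_ge0 ?exprn_ge0.
exact: is_cvg_series_exp_coeff.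
Qed.

Lemma exp_partial_sum_ge0 (R : realType) (t : R) n : 0 <= t ->
  0 <= \sum_(0 <= k < n) t ^+ k / k`!%:R.
Proof. by move=> t0; apply: sumr_ge0 => k _; rewrite divr_ge0 ?exprn_ge0. Qed.

Lemma Phi_ge0 (R : realType) (p t : R) : 0 <= t -> 0 <= Phi p t.
Proof. by move=> t0; rewrite subr_ge0 exp_partial_sum_le. Qed.

Lemma Phi_le_expR (R : realType) (p t : R) : 0 <= t -> Phi p t <= expR t.
Proof. by move=> t0; rewrite gerBl exp_partial_sum_ge0. Qed.

(** The series of Phi starts at the power ceil(p - 2) + 1 >= p - 1, which is what
    bounds Phi (alpha |u|^p') by a multiple of |u|^p where u is small. *)
Lemma subr1_le_truncation (R : realType) (p : R) :
  p - 1 <= (`|Num.ceil (p - 2)|%N.+1)%:R.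
Proof.
rewrite -addn1 natrD -lerBlDr natr_absz.
rewrite (_ : p - 1 - 1 = p - 2); last by ring.
by apply: le_trans (Num.Theory.ceil_ge _) _; rewrite ler_int ler_norm.
Qed.

(** For k >= N one has t^k <= t^N on [0, 1]; factor it out of the tail. *)
Lemma exp_tail_le (R : realType) (t : R) N : 0 <= t <= 1 ->
  expR t - \sum_(0 <= k < N) t ^+ k / k`!%:R <= expR 1 * t ^+ N.
Proof.
move=> /andP[t0 t1]; rewrite lerBlDl.
apply: limr_le; first exact: is_cvg_series_exp_coeff.
exists N => // M /= NM.
rewrite /series/= (@big_cat_nat _ _ _ N)//= lerD2l /exp_coeff/=.
apply: (@le_trans _ _ (\sum_(0 <= k < M) 1 ^+ k / k`!%:R * t ^+ N)).
  rewrite [leRHS](@big_cat_nat _ _ _ N)//= -[leLHS]add0r; apply: lerD.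
    by apply: sumr_ge0 => k _; rewrite mulr_ge0 ?exprn_ge0// divr_ge0 ?exprn_ge0.
  rewrite !big_nat; apply: ler_sum => k /andP[Nk _].
  rewrite expr1n mul1r mulrC ler_wpM2l// -(subnKC Nk) exprD ler_piMr ?exprn_ge0//.
  exact: exprn_ile1.
rewrite -mulr_suml; apply: ler_wpM2r; first exact: exprn_ge0.
exact: exp_partial_sum_le.
Qed.

Lemma Phi_le_powR (R : realType) (p t : R) : 0 <= t <= 1 ->
  Phi p t <= expR 1 * t `^ (p - 1).
Proof.
move=> /andP[t0 t1]; apply: (le_trans (exp_tail_le _ _)); first by rewrite t0.
apply: ler_wpM2l; first exact: expR_ge0.
move: t0; rewrite le_eqVlt => /predU1P[<-|t0]; first by rewrite expr0n/= powR_ge0.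
rewrite -(powR_mulrn _ (ltW t0)); apply: ger_powR; first by rewrite t0.
exact: subr1_le_truncation.
Qed.

(** A term t^k / k! of the subtracted polynomial is kappa^k times the
    corresponding term for t / kappa, and k is smaller than the truncation
    order.  The polynomial is thus negligible in front of exp t. *)
Lemma le_Phi (R : realType) (p t kappa : R) : 0 <= t -> 1 <= kappa ->
  expR t - kappa ^+ `|Num.ceil (p - 2)|%N.+1 * expR (t / kappa) <= Phi p t.
Proof.
move=> t0 k1; rewrite lerD2l lerN2; set N := _.+1.
have k0 : 0 < kappa by lra.
have tk0 : 0 <= t / kappa by rewrite divr_ge0// ltW.
apply: le_trans (ler_wpM2l (exprn_ge0 N (ltW k0)) (exp_partial_sum_le N tk0)).
rewrite mulr_sumr !big_nat; apply: ler_sum => k /andP[_ kN].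
rewrite mulrA; apply: ler_wpM2r => //.
rewrite -[in leLHS](divfK (lt0r_neq0 k0) t) exprMn mulrC; apply: ler_wpM2r.
  exact: exprn_ge0.
by apply: ler_weXn2l => //; exact: ltnW.
Qed.

(** The lower bound [le_Phi] is exp (t / kappa) >= exp L times
    exp (t - t / kappa) - kappa^N, and the last exponential is at least
    1 + (kappa - 1) L. *)
Lemma le_Phi_expRN (R : realType) (p t L kappa : R) : 1 < kappa -> 0 <= L ->
  kappa * L <= t ->
  1 + (kappa - 1) * L - kappa ^+ `|Num.ceil (p - 2)|%N.+1 <= Phi p t * expR (- L).
Proof.
move=> k1 L0 kLt; set K := _ ^+ _; have k0 : 0 < kappa by lra.
have t0 : 0 <= t by apply: le_trans kLt; rewrite mulr_ge0// ltW.
have P0 : 0 <= Phi p t * expR (- L) by rewrite mulr_ge0 ?Phi_ge0 ?expR_ge0.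
have [|neg] := leP 0 (1 + (kappa - 1) * L - K); last by apply: le_trans P0; exact: ltW.
move=> pos; have := le_Phi p t0 (ltW k1); rewrite -/K => tP.
have Lt : L <= t / kappa by rewrite ler_pdivlMr// mulrC.
have -> : 1 + (kappa - 1) * L - K = (1 + (kappa - 1) * L - K) * (expR L * expR (- L)).
  by rewrite -expRD subrr expR0 mulr1.
rewrite mulrA ler_wpM2r ?expR_ge0//; apply: le_trans tP.
have -> : expR t = expR (t - t / kappa) * expR (t / kappa).
  by rewrite -expRD subrK.
rewrite -mulrBl; apply: ler_pM => //; last by rewrite ler_expR.
rewrite lerB// (le_trans _ (expR_ge1Dx _))// lerD2l.
have -> : t - t / kappa = (kappa - 1) * (t / kappa) by field; exact: lt0r_neq0.
by apply: ler_wpM2l => //; lra.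
Qed.

(** * The Sobolev-Slobodeckij norm as integrals *)

Lemma poweR_Lnorm_EFin (R : realType) (p : R) (u : R -> R) : p != 0 ->
  ('N[@lebesgue_measure R]_p%:E [EFin \o u] `^ p =
   \int[@lebesgue_measure R]_x (`|u x| `^ p)%:E)%E.
Proof. by move=> p0; rewrite poweR_Lnorm. Qed.

Lemma poweR_gagliardo (R : realType) (p : R) (u : R -> R) : p != 0 ->
  (gagliardo p u `^ p = \int[@lebesgue_measure R]_y \int[@lebesgue_measure R]_x
      (`|u x - u y| `^ p / `|x - y| ^+ 2)%:E)%E.
Proof.
move=> p0; rewrite -poweRrM mulVf// poweRe1//; apply: integral_ge0 => y _.
by apply: integral_ge0 => x _; rewrite lee_fin divr_ge0 ?powR_ge0 ?exprn_ge0.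
Qed.

Lemma poweRV_le1 (R : realType) (p : R) (X : \bar R) : 0 < p -> (0 <= X)%E ->
  (X `^ p^-1 <= 1)%E = (X <= 1)%E.
Proof.
move=> p0 X0; have Xp : X = ((X `^ p^-1) `^ p)%E.
  by rewrite -poweRrM mulVf ?poweRe1// lt0r_neq0.
apply/idP/idP => H; last first.
  rewrite -(poweR1r p^-1); apply: gt0_ler_poweR H;
  by rewrite ?invr_ge0 ?ltW// in_itv/= ?X0 ?leey ?lee01.
rewrite Xp -(poweR1r p); apply: gt0_ler_poweR H;
by rewrite ?ltW// in_itv/= ?poweR_ge0 ?leey ?lee01.
Qed.

Lemma Wsp_norm_le1 (R : realType) (p : R) (u : R -> R) : 0 < p ->
  (Wsp_norm p u <= 1)%E =
  (\int[@lebesgue_measure R]_x (`|u x| `^ p)%:E +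
   \int[@lebesgue_measure R]_y \int[@lebesgue_measure R]_x
      (`|u x - u y| `^ p / `|x - y| ^+ 2)%:E <= 1)%E.
Proof.
move=> p0; rewrite poweRV_le1//; last by rewrite adde_ge0 ?poweR_ge0.
by rewrite poweR_Lnorm_EFin ?poweR_gagliardo ?lt0r_neq0.
Qed.

Lemma integral_powR_ge0 (R : realType) (p : R) (u : R -> R) :
  (0 <= \int[@lebesgue_measure R]_x (`|u x| `^ p)%:E)%E.
Proof. by apply: integral_ge0 => x _; rewrite lee_fin powR_ge0. Qed.

Lemma integral_gagliardo_ge0 (R : realType) (p : R) (u : R -> R) :
  (0 <= \int[@lebesgue_measure R]_y \int[@lebesgue_measure R]_x
      (`|u x - u y| `^ p / `|x - y| ^+ 2)%:E)%E.
Proof.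
apply: integral_ge0 => y _; apply: integral_ge0 => x _.
by rewrite lee_fin divr_ge0 ?powR_ge0 ?exprn_ge0.
Qed.

Lemma measurable_gagliardo_integrand (R : realType) (p : R) (g : R -> R) :
  measurable_fun setT g ->
  measurable_fun setT (fun z : measurableTypeR R * measurableTypeR R =>
    (`|g z.1 - g z.2| `^ p / `|z.1 - z.2| ^+ 2)%:E).
Proof.
move=> mg; apply/measurable_EFinP; apply: measurable_funM.
  apply: measurable_fun_powR; apply: measurableT_comp => //.
  by apply: measurable_funB; [exact: measurable_comp_fst|exact: measurable_comp_snd].
apply: measurable_funV; apply: measurable_funX; apply: measurableT_comp => //.
by apply: measurable_funB; [exact: measurable_fst|exact: measurable_snd].
Qed.

(** * Finiteness of the supremum for small exponents *)

(** Where X <= 5 the argument of Phi is at most 1 and Phi is bounded by a power.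
    Elsewhere X lies in a shell 5 (n+1)^(1-s) <= X < 5 (n+2)^(1-s), on which
    Phi is at most exp (alpha 5^p' (n+2)): this is one term of the series. *)
Lemma Phi_pointwise_le (R : realType) (s p alpha X : R) : 0 < s -> s < 1 ->
  1 < p -> s * p = 1 -> 0 <= alpha -> alpha * 5 `^ (1 - s)^-1 <= 1 -> 0 <= X ->
  ((Phi p (alpha * X `^ (1 - s)^-1))%:E <=
   (expR 1 * alpha `^ (p - 1) * X `^ p)%:E +
   \sum_(0 <= n <oo) (expR (alpha * 5 `^ (1 - s)^-1) ^+ n.+2 *
      (5 * n.+1%:R `^ (1 - s) <= X)%R%:R)%:E)%E.
Proof.
move=> s0 s1 p1 sp a0 a1 X0; set r := (1 - s)^-1; set rho := expR (alpha * _).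
have r0 : 0 < r by rewrite invr_gt0; lra.
have sE : s = p^-1 by rewrite -[LHS](mulfK (_ : p != 0)) ?sp ?div1r// lt0r_neq0//; lra.
have rp : r * (p - 1) = p.
  by rewrite /r sE; field; apply/andP; split; rewrite lt0r_neq0//; lra.
have t_ge0 n : (0 <= (rho ^+ n.+2 * (5 * n.+1%:R `^ (1 - s) <= X)%R%:R)%:E)%E.
  by rewrite lee_fin mulr_ge0// exprn_ge0// expR_ge0.
have Xr0 : 0 <= X `^ r by exact: powR_ge0.
have [X5|X5] := leP X 5.
  rewrite -[leLHS]adde0; apply: leeD; last by apply: nneseries_ge0.
  have Xr : X `^ r <= 5 `^ r by apply: ge0_ler_powR; rewrite ?nnegrE//; lra.
  rewrite lee_fin; apply: le_trans (Phi_le_powR p _) _.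
    rewrite mulr_ge0//=; apply: le_trans a1; exact: ler_wpM2l.
  by rewrite powRM// -powRrM rp mulrA.
rewrite -[leLHS]add0e; apply: leeD.
  by rewrite lee_fin !mulr_ge0 ?powR_ge0 ?expR_ge0.
(* The index of the shell of X is n with n + 1 the integer part of (X / 5)^p'. *)
pose Z := (X / 5) `^ r.
have Z1 : 1 <= Z.
  rewrite -(powRr0 (X / 5)); apply: ler_powR; last exact: ltW.
  by rewrite ler_pdivlMr; lra.
have [n tn] : exists n, Num.trunc Z = n.+1.
  exists (Num.trunc Z).-1; rewrite prednK// truncn_gt0//.
have Z0 : 0 <= Z by exact: powR_ge0.
have /andP[nZ Zn] := truncn_itv Z0; rewrite tn in nZ Zn.
have rs : r * (1 - s) = 1 by rewrite mulVf// lt0r_neq0; lra.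
have nX : 5 * n.+1%:R `^ (1 - s) <= X.
  rewrite mulrC -ler_pdivlMr//.
  have -> : X / 5 = Z `^ (1 - s) by rewrite -powRrM rs powRr1// divr_ge0.
  by apply: ge0_ler_powR; rewrite ?nnegrE//; lra.
have ZE : X `^ r = Z * 5 `^ r.
  by rewrite -powRM ?divr_ge0// divfK.
apply: (@le_trans _ _ (rho ^+ n.+2 * (5 * n.+1%:R `^ (1 - s) <= X)%R%:R)%:E).
  rewrite nX mulr1 lee_fin; apply: (le_trans (Phi_le_expR _ _)).
    exact: mulr_ge0.
  rewrite -expRM_natl ler_expR ZE mulrCA.
  by apply: ler_wpM2r; [rewrite mulr_ge0 ?powR_ge0|exact: ltW].
apply: le_trans (nneseries_lim_ge n.+1 _); last by move=> *; exact: t_ge0.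
by rewrite big_nat_recr//= leeDr// sume_ge0.
Qed.

(** The shell n has measure at most 2^-(n+1), so the series over the shells is
    geometric of ratio exp (alpha 5^p') / 2 < 1, independently of u. *)
Lemma MT_sup_lty (R : realType) (s p alpha : R) : 0 < s -> s < 1 ->
  1 < p -> s * p = 1 -> 0 <= alpha -> alpha * 5 `^ (1 - s)^-1 < ln 2 ->
  (MT_sup s p alpha < +oo)%E.
Proof.
move=> s0 s1 p1 sp a0 aln2; have p0 : 0 < p by lra.
have a1 : alpha * 5 `^ (1 - s)^-1 <= 1.
  apply/ltW/(lt_le_trans aln2); have := @le_ln1Dx R 1; apply; lra.
have sE : s = p^-1.
  by rewrite -[LHS](mulfK (_ : p != 0)) ?sp ?div1r// lt0r_neq0.
set rho := expR (alpha * 5 `^ (1 - s)^-1).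
have rho0 : 0 <= rho by exact: expR_ge0.
have rho2 : rho < 2 by rewrite -(@lnK R 2) ?posrE// ltr_expR.
pose c : R := expR 1 * alpha `^ (p - 1).
have c0 : 0 <= c by rewrite mulr_ge0 ?expR_ge0 ?powR_ge0.
pose B : \bar R := (c%:E + \sum_(0 <= n <oo) ((rho ^+ 2 / 2) * (rho / 2) ^+ n)%:E)%E.
have B_lty : (B < +oo)%E.
  rewrite lte_add_pinfty ?ltry// nneseries_geometric_lty//.
    by rewrite divr_ge0 ?exprn_ge0.
  by rewrite divr_ge0//= ltr_pdivrMr// mul1r.
apply: le_lt_trans B_lty; apply: ge_ereal_sup => _ [u [[uL _] uN] <-].
have mesu : measurable_fun setT u.
  by move: uL; rewrite inE => /andP[+ _]; rewrite inE.
have mf : measurable_fun setT (fun x => `|u x|) by exact: measurableT_comp.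
have [Np Gp] : (\int[@lebesgue_measure R]_x (`|u x| `^ p)%:E <= 1)%E /\
    (\int[@lebesgue_measure R]_y \int[@lebesgue_measure R]_x
      (`|u x - u y| `^ p / `|x - y| ^+ 2)%:E <= 1)%E.
  move: uN; rewrite Wsp_norm_le1// => uN; split; apply: le_trans uN.
    by rewrite leeDl// integral_gagliardo_ge0.
  by rewrite leeDr// integral_powR_ge0.
pose A n := [set x | 5 * n.+1%:R `^ (1 - s) <= `|u x|].
have mA n : measurable (A n) by exact: measurable_ger.
pose g n x : \bar R := (rho ^+ n.+2 * \1_(A n) x)%:E.
have g0 n x : (0 <= g n x)%E by rewrite lee_fin mulr_ge0 ?exprn_ge0.
have mg n : measurable_fun setT (g n).
  by apply/measurable_EFinP; apply: measurable_funM.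
have mh : measurable_fun setT (fun x => (c * `|u x| `^ p)%:E).
  by apply/measurable_EFinP; apply: measurable_funM => //; exact: measurable_fun_powR.
apply: (@le_trans _ _ (\int[@lebesgue_measure R]_x
    ((c * `|u x| `^ p)%:E + \sum_(0 <= n <oo) g n x))%E).
  apply: ge0_le_integral_nomeas => x _.
    by rewrite lee_fin Phi_ge0// mulr_ge0 ?powR_ge0.
  apply: le_trans (Phi_pointwise_le s0 s1 p1 sp a0 a1 (normr_ge0 (u x))) _.
  rewrite leeD2l//; apply: lee_nneseries => n _; first last.
    rewrite /g indicE (_ : (x \in A n) = (5 * n.+1%:R `^ (1 - s) <= `|u x|))//.
    by apply/idP/idP; rewrite inE.
  by rewrite lee_fin mulr_ge0 ?exprn_ge0.
rewrite ge0_integralD//; last 3 first.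
- by move=> x _; rewrite lee_fin mulr_ge0 ?powR_ge0.
- by move=> x _; apply: nneseries_ge0.
- by apply: ge0_emeasurable_sum => *; [exact: g0|exact: mg].
apply: leeD.
  under eq_integral do rewrite EFinM.
  rewrite ge0_integralZl_EFin//; last first.
    by apply/measurable_EFinP; exact: measurable_fun_powR.
  by rewrite -[leRHS]mule1; apply: lee_wpmul2l.
rewrite integral_nneseries//; apply: lee_nneseries => n.
  by move=> *; exact: integral_ge0.
move=> _.
rewrite ge0_integral_cst_indic; [|exact: exprn_ge0|exact: mA].
apply: (@le_trans _ _ ((rho ^+ n.+2)%:E * (2 ^- n.+1)%:E)%E).
  apply: lee_wpmul2l; first by rewrite lee_fin exprn_ge0.
  by rewrite /A sE; apply: measure_superlevel_decay.
rewrite -EFinM lee_fin exprMn -!exprVn !exprS.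
by rewrite le_eqVlt; apply/orP; left; apply/eqP; ring.
Qed.

(** * Tonelli on domains and changes of variables *)

Lemma fubini_tonelli_dom (R : realType) (A B : set (measurableTypeR R))
    (f : measurableTypeR R * measurableTypeR R -> \bar R) :
  measurable A -> measurable B -> measurable_fun setT f ->
  (forall z, 0 <= f z)%E ->
  (\int[@lebesgue_measure R]_(x in A) \int[@lebesgue_measure R]_(y in B) f (x, y) =
   \int[@lebesgue_measure R]_(y in B) \int[@lebesgue_measure R]_(x in A) f (x, y))%E.
Proof.
move=> mA mB mf f0.
have mAB : measurable (A `*` B) by exact: measurableX.
have mfAB : measurable_fun setT (f \_ (A `*` B)).
  apply: (proj1 (measurable_restrictT f mAB)); exact: measurable_funTS.
have fAB0 z : (0 <= (f \_ (A `*` B)) z)%E by rewrite /patch; case: ifPn.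
have := @fubini_tonelli _ _ _ _ R (@lebesgue_measure R) (@lebesgue_measure R) _
  mfAB fAB0.
have -> : (fun x => \int[@lebesgue_measure R]_y (f \_ (A `*` B)) (x, y))%E =
   ((fun x => \int[@lebesgue_measure R]_(y in B) f (x, y))%E \_ A).
  apply/funext => x; rewrite /patch; case: ifPn => xA.
    rewrite [RHS]integral_mkcond; apply: eq_integral => y _.
    by rewrite /patch in_setX/= xA.
  by rewrite integral0_eq// => y _; rewrite in_setX/= (negbTE xA).
have -> : (fun y => \int[@lebesgue_measure R]_x (f \_ (A `*` B)) (x, y))%E =
   ((fun y => \int[@lebesgue_measure R]_(x in A) f (x, y))%E \_ B).
  apply/funext => y; rewrite /patch; case: ifPn => yB.
    rewrite [RHS]integral_mkcond; apply: eq_integral => x _.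
    by rewrite /patch in_setX/= yB andbT.
  by rewrite integral0_eq// => x _; rewrite in_setX/= (negbTE yB) andbF.
by rewrite -!integral_mkcond.
Qed.

Lemma measurable_integral_dom (R : realType) (A : set (measurableTypeR R))
    (f : measurableTypeR R * measurableTypeR R -> \bar R) :
  measurable A -> measurable_fun setT f -> (forall z, 0 <= f z)%E ->
  measurable_fun setT (fun y => \int[@lebesgue_measure R]_(x in A) f (x, y))%E.
Proof.
move=> mA mf f0.
have mAT : measurable (A `*` @setT (measurableTypeR R)) by exact: measurableX.
have mfA : measurable_fun setT (f \_ (A `*` setT)).
  apply: (proj1 (measurable_restrictT f mAT)); exact: measurable_funTS.
have fA0 z : (0 <= (f \_ (A `*` setT)) z)%E by rewrite /patch; case: ifPn.
have := @measurable_fun_fubini_tonelli_G _ _ _ _ R (@lebesgue_measure R) _ mfA fA0.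
congr (measurable_fun _ _); apply/funext => y; rewrite /fubini_G [RHS]integral_mkcond.
by apply: eq_integral => x _; rewrite /patch in_setX/= in_setT andbT.
Qed.

Lemma integral_reflect (R : realType) (f : R -> \bar R) :
  measurable_fun setT f -> (forall x, 0 <= f x)%E ->
  (\int[@lebesgue_measure R]_x f x =
   \int[@lebesgue_measure R]_(x in `]0%R, +oo[) (f x + f (- x)%R))%E.
Proof.
move=> mf f0.
have mfN : measurable_fun setT (fun x : R => f (- x)).
  by apply: measurableT_comp => //; exact: oppr_measurable.
rewrite ge0_integralD//; [|exact: measurable_funTS|exact: measurable_funTS].
rewrite [X in (_ + X)%E](integral_itv_obnd_cbnd); last exact: measurable_funTS.
rewrite ge0_integration_by_substitution0//.
under [X in (_ + X)%E]eq_integral do rewrite opprK.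
rewrite addeC -ge0_integral_setU//=.
- by congr integral; rewrite -set_itvNyy (@itv_bndbnd_setU _ _ _ (BRight 0)).
- exact: measurable_funTS.
apply/disj_setPRL => x /=; rewrite !in_itv/= andbT => x0 x0'.
by move: (le_lt_trans x0' x0); rewrite ltxx.
Qed.

(** The half x < y of the square carries half of the integral, by Tonelli and
    symmetry; the diagonal contributes nothing since F vanishes there. *)
Lemma integral_symmetric (R : realType)
    (F : measurableTypeR R * measurableTypeR R -> \bar R) (A : set (measurableTypeR R)) :
  measurable A -> measurable_fun setT F -> (forall z, 0 <= F z)%E ->
  (forall x y, F (x, y) = F (y, x)) -> (forall x, F (x, x) = 0%E) ->
  (\int[@lebesgue_measure R]_(y in A) \int[@lebesgue_measure R]_(x in A) F (x, y) =
   2%:E * \int[@lebesgue_measure R]_(y in A) \int[@lebesgue_measure R]_(x in A)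
     (if (x < y)%R then F (x, y) else 0))%E.
Proof.
move=> mA mF F0 Fsym Fdiag.
pose T2 : measurableType _ := (measurableTypeR R * measurableTypeR R)%type.
(* The part of F where x < y; F3' is its mirror image. *)
pose F3 (z : T2) : \bar R := if (z.1 < z.2)%R then F z else 0%E.
have F30 z : (0 <= F3 z)%E by rewrite /F3; case: ifP.
have mF3 : measurable_fun setT F3.
  apply: measurable_fun_ifT => //; apply: measurable_fun_ltr.
  - exact: measurable_fst.
  - exact: measurable_snd.
pose F3' (z : T2) : \bar R := F3 (z.2, z.1).
have mF3' : measurable_fun setT F3'.
  apply: (measurableT_comp mF3); apply: measurable_fun_pair.
  - exact: measurable_snd.
  - exact: measurable_fst.
have FE x y : F (x, y) = (F3 (x, y) + F3' (x, y))%E.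
  rewrite /F3' /F3/=; case: (ltgtP x y) => [xy|yx|->].
  - by rewrite adde0.
  - by rewrite add0e Fsym.
  - by rewrite adde0.
have mpair (G : T2 -> \bar R) y : measurable_fun setT G ->
    measurable_fun setT (fun x => G (x, y)).
  by move=> mG; exact: measurableT_comp mG (measurable_pair2 y).
have F3'0 z : (0 <= F3' z)%E by exact: F30.
transitivity (\int[@lebesgue_measure R]_(y in A)
    (\int[@lebesgue_measure R]_(x in A) F3 (x, y) +
     \int[@lebesgue_measure R]_(x in A) F3' (x, y)))%E.
  apply: eq_integral => y _; under eq_integral do rewrite FE.
  rewrite ge0_integralD//.
  - by apply: measurable_funTS; exact: mpair.
  - by apply: measurable_funTS; exact: mpair.
rewrite ge0_integralD//.
- by rewrite [X in (_ + X)%E](fubini_tonelli_dom mA mA mF3 F30) -mule2n mule_natl.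
- by move=> y _; exact: integral_ge0.
- by apply: measurable_funTS; exact: measurable_integral_dom.
- by move=> y _; exact: integral_ge0.
- by apply: measurable_funTS; exact: measurable_integral_dom.
Qed.

(** The image of Lebesgue measure under r |-> c r, multiplied by c, gives each
    interval its length, hence is Lebesgue measure. *)
Lemma ge0_integral_scale (R : realType) (c : R) (D : set R) (f : R -> \bar R) :
  0 < c -> measurable D -> measurable_fun D f -> (forall x, D x -> 0 <= f x)%E ->
  (\int[@lebesgue_measure R]_(x in D) f x =
   c%:E * \int[@lebesgue_measure R]_(r in (fun r => c * r)%R @^-1` D) f (c * r)%R)%E.
Proof.
move=> c0 mD mf f0; pose T := measurableTypeR R.
have mphi : measurable_fun setT (fun r : T => (c * r)%R : T).
  exact: mulrl_measurable.
have mD' : measurable (D : set T) by [].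
have mf' : measurable_fun (D : set T) (f : T -> \bar R) by [].
have := @ge0_integral_pushforward _ _ T T R _ mphi (@lebesgue_measure R) D f mD' mf' _.
move=> /(_ _)/= <-; last by move=> x; rewrite inE; exact: f0.
set pf := (X in _ = (_ * \int[X]_(x in _) _)%E).
have <- := @ge0_integral_mscale _ T R pf D mD' (NngNum (ltW c0)) f mf' f0.
apply: eq_measure_integral => A mA _.
apply: lebesgue_measure_unique => //= _ [[a b]] _ <-.
rewrite /= /mscale/= /pushforward.
rewrite (_ : _ @^-1` _ = `](a / c), (b / c)]%classic); last first.
  by apply/seteqP; split => x /=; rewrite !in_itv/= ltr_pdivrMr// ler_pdivlMr// mulrC.
rewrite !lebesgue_measure_itv/= !lte_fin ltr_pM2r ?invr_gt0//.
case: ifPn => ab; last by rewrite mule0.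
by rewrite -!EFinB -EFinM; congr EFin; field; exact: lt0r_neq0.
Qed.

Lemma ge0_integral_scale_y (R : realType) (c : R) (f : R -> \bar R) : 0 < c ->
  measurable_fun setT f -> (forall x, (0 < x)%R -> 0 <= f x)%E ->
  (\int[@lebesgue_measure R]_(x in `]0%R, +oo[) f x =
   c%:E * \int[@lebesgue_measure R]_(r in `]0%R, +oo[) f (c * r)%R)%E.
Proof.
move=> c0 mf f0; rewrite (ge0_integral_scale c0)//; last 2 first.
- exact: measurable_funTS.
- by move=> x /=; rewrite in_itv/= andbT; exact: f0.
congr (_ * _)%E; congr integral; apply/seteqP.
by split => x /=; rewrite !in_itv/= !andbT pmulr_rgt0.
Qed.

Lemma is_derive_expRN (R : realType) (x : R) :
  is_derive x 1 (fun t => expR (- t)) (- expR (- x)).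
Proof.
have -> : - expR (- x) = expR (- x) * -1 by rewrite mulrN1.
exact: (@is_derive1_comp R expR (fun t => - t)).
Qed.

Lemma continuous_expRN (R : realType) : continuous (fun t : R => expR (- t)).
Proof.
by move=> x; apply: (@continuous_comp _ _ _ (fun t : R => - t) expR);
  [exact: opp_continuous|exact: continuous_expR].
Qed.

Lemma integral_expRN_subst (R : realType) (q : R -> R) (a b : R) :
  0 < a -> a <= b -> {in `]0, +oo[, continuous q} ->
  (\int[@lebesgue_measure R]_(r in `[expR (- b), expR (- a)]) (q (- ln r))%:E =
   \int[@lebesgue_measure R]_(t in `[a, b]) (q t * expR (- t))%:E)%E.
Proof.
move=> a0 ab cq.
have dE : (fun t : R => expR (- t))^`()%classic = (fun t => - expR (- t)).
  apply/funext => x; rewrite derive1E.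
  by rewrite (@derive_val _ _ _ _ _ _ _ (is_derive_expRN x)).
have cdE : continuous (fun t : R => - expR (- t)).
  by move=> x; apply: cvgN; exact: continuous_expRN.
rewrite (@integration_by_substitution_decreasing _ (fun t => expR (- t)) _ a b)//.
- apply: eq_integral => t _; rewrite dE/= !fctE/= opprK.
  by rewrite expRK opprK.
- by move=> x y _ _ xy; rewrite ltr_expR ltrN2.
- by rewrite dE => x _; exact: cdE.
- by rewrite dE; apply/cvg_ex; eexists; apply: cvg_at_right_filter; exact: cdE.
- by rewrite dE; apply/cvg_ex; eexists; apply: cvg_at_left_filter; exact: cdE.
- split.
  + by move=> x _; apply: ex_derive; exact: is_derive_expRN.
  + by apply: cvg_at_right_filter; exact: continuous_expRN.
  + by apply: cvg_at_left_filter; exact: continuous_expRN.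
- apply: continuous_in_subspaceT => r; rewrite inE/= in_itv/= => /andP[br ra].
  have r0 : 0 < r by rewrite (lt_le_trans (expR_gt0 _) br).
  apply: (@continuous_comp _ _ _ (fun r : R => - ln r) q).
    by apply: cvgN; exact: continuous_ln.
  apply: cq; rewrite in_itv/= andbT oppr_gt0 ln_lt0// r0/=.
  by rewrite (le_lt_trans ra)// expR_lt1 oppr_lt0.
Qed.

(** The substitution r = exp (- t), first on the compact intervals
    [1/(n+1), n+1] of t and their images in ]0, 1[, then by exhaustion. *)
Lemma integral_lnN (R : realType) (q : R -> R) :
  measurable_fun setT q -> (forall t, 0 < t -> 0 <= q t) ->
  {in `]0, +oo[, continuous q} ->
  (\int[@lebesgue_measure R]_(r in `]0%R, 1%R[) (q (- ln r))%:E =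
   \int[@lebesgue_measure R]_(t in `]0%R, +oo[) (q t * expR (- t))%:E)%E.
Proof.
move=> mq q0 cq.
pose B n : set R := `[n.+1%:R^-1, n.+1%:R]%classic.
pose A n : set R := `[expR (- n.+1%:R), expR (- n.+1%:R^-1)]%classic.
have nV (n : nat) : 0 < n.+1%:R^-1 :> R by rewrite invr_gt0.
have nVn (n : nat) : n.+1%:R^-1 <= n.+1%:R :> R.
  by apply: (@le_trans _ _ 1); rewrite ?invf_le1 ?ler1n.
have ndV n m : (n <= m)%N -> m.+1%:R^-1 <= n.+1%:R^-1 :> R.
  by move=> nm; rewrite lef_pV2 ?posrE// ler_nat.
have nd n m : (n <= m)%N -> n.+1%:R <= m.+1%:R :> R by rewrite ler_nat.
have ndB : {homo B : n m / (n <= m)%N >-> (n <= m)%O}.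
  move=> n m nm; apply/subsetPset => x; rewrite /B/= !in_itv/= => /andP[nx xn].
  by rewrite (le_trans (ndV _ _ nm) nx) (le_trans xn (nd _ _ nm)).
have ndA : {homo A : n m / (n <= m)%N >-> (n <= m)%O}.
  move=> n m nm; apply/subsetPset => x; rewrite /A/= !in_itv/= => /andP[nx xn].
  rewrite (le_trans _ nx) ?ler_expR ?lerN2 ?nd//=.
  by rewrite (le_trans xn)// ler_expR lerN2 ndV.
have UB : \bigcup_n B n = `]0, +oo[%classic.
  apply/seteqP; split => x /=; rewrite in_itv/= andbT.
    by move=> [n _]; rewrite /B/= in_itv/= => /andP[+ _]; exact: lt_le_trans.
  move=> x0; have [n nx] := exists_invSn_lt x0.
  exists (maxn n (Num.trunc x)) => //; rewrite /B/= in_itv/=; apply/andP; split.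
    apply: le_trans (ltW nx); apply: ndV; exact: leq_maxl.
  apply: (le_trans (ltW (truncnS_gt x))); apply: nd; exact: leq_maxr.
have UA : \bigcup_n A n = `]0, 1[%classic.
  apply/seteqP; split => x /=; rewrite in_itv/=.
    move=> [n _]; rewrite /A/= in_itv/= => /andP[nx xn].
    by rewrite (lt_le_trans (expR_gt0 _) nx)/= (le_lt_trans xn)// expR_lt1 oppr_lt0.
  move=> /andP[x0 x1].
  have : (\bigcup_n B n) (- ln x).
    by rewrite UB/= in_itv/= andbT oppr_gt0 ln_lt0// x0.
  move=> [n _]; rewrite /B/= in_itv/= => /andP[n1 n2]; exists n => //.
  by rewrite /A/= in_itv/= -(@lnK R x)// !ler_expR lerNl n2 lerNr.
have mqln : measurable_fun setT (fun r : R => (q (- ln r))%:E).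
  apply/measurable_EFinP; apply: measurableT_comp => //.
  by apply: measurable_funN; exact: measurable_ln.
have mqe : measurable_fun setT (fun t : R => (q t * expR (- t))%:E).
  apply/measurable_EFinP; apply: measurable_funM => //.
  exact: continuous_measurable_fun (@continuous_expRN R).
have subA n x : A n x -> 0 < - ln x.
  move=> Ax; have : (\bigcup_n A n) x by exists n.
  by rewrite UA/= in_itv/= oppr_gt0 => x01; exact: ln_lt0.
have subB n x : B n x -> 0 < x.
  move=> Bx; have : (\bigcup_n B n) x by exists n.
  by rewrite UB/= in_itv/= andbT.
have cA : (\int[@lebesgue_measure R]_(r in A n) (q (- ln r))%:E @[n --> \oo] -->
    \int[@lebesgue_measure R]_(r in \bigcup_n A n) (q (- ln r))%:E)%E.
  apply: ge0_nondecreasing_set_cvg_integral => // [n|n|n x Ax].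
  - exact: measurable_itv.
  - exact: measurable_funTS.
  - by rewrite lee_fin q0// (subA n).
have cB : (\int[@lebesgue_measure R]_(t in B n) (q t * expR (- t))%:E @[n --> \oo] -->
    \int[@lebesgue_measure R]_(t in \bigcup_n B n) (q t * expR (- t))%:E)%E.
  apply: ge0_nondecreasing_set_cvg_integral => // [n|n|n x Bx].
  - exact: measurable_itv.
  - exact: measurable_funTS.
  - by rewrite lee_fin mulr_ge0 ?expR_ge0// q0// (subB n).
rewrite -UA -UB; apply: (cvg_unique _ cA) => //.
rewrite (_ : (fun n => _) = (fun n => \int[@lebesgue_measure R]_(t in B n)
  (q t * expR (- t))%:E)%E)//.
by apply/funext => n; exact: integral_expRN_subst.
Qed.

(** * Gamma integrals *)

Lemma integral_expRN (R : realType) :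
  (\int[@lebesgue_measure R]_(t in `]0%R, +oo[) (expR (- t))%:E = 1)%E.
Proof.
rewrite integral_itv_obnd_cbnd; last first.
  apply/measurable_EFinP; apply: measurable_funTS.
  exact: continuous_measurable_fun (@continuous_expRN R).
rewrite (@ge0_continuous_FTC2y _ _ (fun t => - expR (- t)) 0 0).
- by rewrite oppr0 expR0 -EFinB opprK add0r.
- by move=> x _; exact: expR_ge0.
- by apply: continuous_subspaceT; exact: continuous_expRN.
- by rewrite -oppr0; apply: cvgN; exact: cvgr_expR.
- by move=> x _; apply: derivableN; apply: ex_derive; exact: is_derive_expRN.
- apply: cvg_at_right_filter; apply: cvgN; exact: continuous_expRN.
- move=> x _; rewrite derive1E deriveN; last by apply: ex_derive; exact: is_derive_expRN.
  by rewrite (@derive_val _ _ _ _ _ _ _ (is_derive_expRN x)) opprK.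
Qed.

Lemma measurable_powR_expR (R : realType) (p c : R) :
  measurable_fun setT (fun t : R => t `^ p * expR (c * t)).
Proof.
apply: measurable_funM; first exact: measurable_fun_powR.
by apply: measurableT_comp => //; exact: measurable_funM.
Qed.

Lemma continuous_powR_expR (R : realType) (p c : R) :
  {in `]0, +oo[, continuous (fun t : R => t `^ p * expR (c * t))}.
Proof.
move=> t t0.
have cp : {for t, continuous (fun t : R => t `^ p)}.
  by apply: differentiable_continuous; apply/derivable1_diffP; exact: derivable_powR.
apply: (@continuousM R R (fun t : R => t `^ p) (fun t : R => expR (c * t))) => //.
apply: (@continuous_comp _ _ _ (fun t : R => c * t) expR).
  by apply: cvgM; [exact: cvg_cst|exact: cvg_id].
exact: continuous_expR.
Qed.

(** From x <= exp x at x = t / (2 p), raised to the power p. *)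
Lemma powR_le_expR (R : realType) (p t : R) : 0 < p -> 0 <= t ->
  t `^ p <= (2 * p) `^ p * expR (t / 2).
Proof.
move=> p0 t0; have -> : t / 2 = (t / (2 * p)) * p by field; exact: lt0r_neq0.
have p2 : 0 < 2 * p by rewrite mulr_gt0.
rewrite expRM -powRM ?expR_ge0//; last exact: ltW.
have tp : 0 <= t / (2 * p) by rewrite divr_ge0// ltW.
have [p0' p2'] := (ltW p0, ltW p2).
apply: ge0_ler_powR; rewrite ?nnegrE ?mulr_ge0 ?expR_ge0//.
rewrite -ler_pdivrMl// mulrC; apply: le_trans (expR_ge1Dx _); lra.
Qed.

(** Gamma is defined as the finite part of an extended integral, so this says
    that the integral converges: it is dominated by that of exp (- t / 2). *)
Lemma integral_Gamma (R : realType) (p : R) : 0 < p ->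
  (\int[@lebesgue_measure R]_(t in `]0%R, +oo[) (t `^ p * expR (- t))%:E =
   (Gamma (p + 1))%:E)%E.
Proof.
move=> p0; rewrite /Gamma addrK /Rintegral fineK//.
rewrite ge0_fin_numE; last first.
  by apply: integral_ge0 => t _; rewrite lee_fin mulr_ge0 ?powR_ge0 ?expR_ge0.
apply: (@le_lt_trans _ _ (\int[@lebesgue_measure R]_(t in `]0%R, +oo[)
    (((2 * p) `^ p)%:E * (expR (- (t / 2)))%:E))%E).
  apply: ge0_le_integral_nomeas => t.
    by rewrite lee_fin mulr_ge0 ?powR_ge0 ?expR_ge0.
  rewrite /= in_itv/= andbT => t0; rewrite -EFinM lee_fin.
  have -> : expR (- (t / 2)) = expR (t / 2) * expR (- t).
    by rewrite -expRD; congr expR; field.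
  by rewrite mulrA ler_wpM2r ?expR_ge0 ?powR_le_expR ?ltW.
have mE : measurable_fun setT (fun t : R => (expR (- (t / 2)))%:E).
  apply/measurable_EFinP; apply: measurableT_comp => //; apply: measurable_funN.
  exact: measurable_funM.
rewrite ge0_integralZl_EFin ?powR_ge0//; last exact: measurable_funTS.
rewrite (@ge0_integral_scale_y _ 2)//.
under eq_integral do rewrite mulrC mulKf//.
by rewrite integral_expRN -!EFinM ltry.
Qed.

Lemma integral_powR_expR (R : realType) (p m : R) : 0 < p -> 0 < m ->
  (\int[@lebesgue_measure R]_(t in `]0%R, +oo[) (t `^ p * expR (- (m * t)))%:E =
   (m `^ (- (p + 1)) * Gamma (p + 1))%:E)%E.
Proof.
move=> p0 m0; rewrite (@ge0_integral_scale_y _ m^-1) ?invr_gt0//; last 2 first.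
- by apply/measurable_EFinP; under eq_fun do rewrite -mulNr; exact: measurable_powR_expR.
- by move=> x _; rewrite lee_fin mulr_ge0 ?powR_ge0 ?expR_ge0.
have mG : measurable_fun (`]0, +oo[ : set R) (fun t : R => (t `^ p * expR (- t))%:E).
  apply: measurable_funTS; apply/measurable_EFinP.
  by under eq_fun do rewrite -mulN1r; exact: measurable_powR_expR.
rewrite (_ : (\int[_]_(r in _) _)%E = (\int[@lebesgue_measure R]_(t in `]0%R, +oo[)
    (((m^-1) `^ p)%:E * (t `^ p * expR (- t))%:E))%E); last first.
  apply: eq_integral => t; rewrite inE/= in_itv/= andbT => t0.
  have [m0' t0'] : 0 <= m^-1 /\ 0 <= t by rewrite invr_ge0 !ltW.
  by rewrite mulVKf ?lt0r_neq0// -EFinM powRM// mulrA.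
rewrite ge0_integralZl_EFin//; last 2 first.
- by move=> t _; rewrite lee_fin mulr_ge0 ?powR_ge0 ?expR_ge0.
- exact: powR_ge0.
rewrite integral_Gamma// -!EFinM mulrA; congr (_ * _)%:E.
rewrite opprD powRD; last by apply/implyP => _; exact: lt0r_neq0.
rewrite powR_inv1 ?ltW// mulrC -powR_inv1; last exact: ltW.
by rewrite -powRrM mulN1r.
Qed.

Lemma Gamma_ge0 (R : realType) (z : R) : 0 <= Gamma z.
Proof. by apply: Rintegral_ge0 => t _; rewrite mulr_ge0 ?powR_ge0 ?expR_ge0. Qed.

(** * The kernel integral *)

(** The kernel |x - y|^-2 folded along x |-> - x, at x = r and y = 1. *)
Definition kernel2 (R : realType) (r : R) : R := (1 - r) ^- 2 + (1 + r) ^- 2.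

Lemma kernel2_ge0 (R : realType) (r : R) : 0 <= kernel2 r.
Proof. by rewrite addr_ge0// invr_ge0 exprn_even_ge0. Qed.

(** Multiplied by (1 - r^2)^2, the partial sums of sum_k (2 k + 1) r^(2 k)
    telescope. *)
Lemma kernel2_partial_sum (R : realType) (r : R) n : 0 <= r < 1 ->
  kernel2 r = \sum_(0 <= k < n) 2 * (1 + 2 * k%:R) * r ^+ (2 * k) +
    2 * ((2 * n%:R + 1) * r ^+ (2 * n) - (2 * n%:R - 1) * r ^+ (2 * n).+2) /
      (1 - r ^+ 2) ^+ 2.
Proof.
move=> /andP[r0 r1]; have r1' : 1 - r != 0 by rewrite lt0r_neq0//; lra.
have r2' : 1 + r != 0 by rewrite lt0r_neq0//; lra.
have rr : (1 - r ^+ 2) = (1 - r) * (1 + r) by ring.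
elim: n => [|n IH].
  rewrite big_nil add0r muln0 expr0 rr /kernel2; field; exact/andP.
rewrite IH big_nat_recr//= -addrA; congr (_ + _).
rewrite rr mulnS !exprS -[n.+1]addn1 natrD; field; exact/andP.
Qed.

(** Each of the n + 1 first terms of the geometric series is at least r^n. *)
Lemma natSM_expr_le (R : realType) (r : R) n : 0 <= r < 1 ->
  n.+1%:R * r ^+ n <= (1 - r)^-1.
Proof.
move=> /andP[r0 r1]; apply: (@le_trans _ _ (\sum_(0 <= k < n.+1) r ^+ k)).
  rewrite -[n.+1 in leLHS]subn0 -sumr_const_nat mulr_suml.
  rewrite !big_nat; apply: ler_sum => k /andP[_ kn].
  by rewrite mul1r; apply: ler_wiXn2l => //; exact: ltW.
have := geometric_seriesE 1 (_ : r != 1).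
rewrite lt_eqF// => /(_ isT)/(congr1 (fun f => f n.+1)); rewrite /series/=.
under eq_bigr do rewrite mul1r.
move=> ->; rewrite mul1r ler_piMl ?invr_ge0 ?subr_ge0 ?(ltW r1)//.
by rewrite gerBl exprn_ge0.
Qed.

(** The remainder in [kernel2_partial_sum] is at most a constant times r^n, since
    one of the two factors r^n in r^(2 n) absorbs the linear factor. *)
Lemma kernel2_le_series (R : realType) (r : R) : 0 <= r < 1 ->
  ((kernel2 r)%:E <= \sum_(0 <= k <oo) (2 * (1 + 2 * k%:R) * r ^+ (2 * k))%:E)%E.
Proof.
move=> /andP[r0 r1]; apply/lee_addgt0Pr => e e0.
have t0 k : 0 <= 2 * (1 + 2 * k%:R) * r ^+ (2 * k).
  by rewrite mulr_ge0 ?exprn_ge0.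
pose C := 4 * (1 - r)^-1 / (1 - r ^+ 2) ^+ 2.
have C0 : 0 < C.
  have r2 : r ^+ 2 < 1 by rewrite exprn_ilt1.
  by rewrite /C !divr_gt0 ?exprn_gt0 ?subr_gt0.
have /cvgrPdist_lt/(_ _ (divr_gt0 e0 C0))[n _ /(_ n (leqnn n))/=] :
  (fun n => r ^+ n) @ \oo --> 0 by apply: cvg_expr; rewrite ger0_norm.
rewrite sub0r normrN ger0_norm ?exprn_ge0// ltr_pdivlMr// mulrC => rn.
rewrite (@kernel2_partial_sum _ _ n); last by rewrite r0.
rewrite EFinD; apply: leeD.
  rewrite -sumEFin; apply: nneseries_lim_ge => k _ _; by rewrite lee_fin.
rewrite lee_fin; apply: le_trans (ltW rn); rewrite /C [leRHS]mulrAC.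
apply: ler_wpM2r; first by rewrite invr_ge0 exprn_ge0// subr_ge0 exprn_ile1// ltW.
have rS : r ^+ (2 * n) = r ^+ n * r ^+ n by rewrite mul2n -addnn exprD.
have := @natSM_expr_le _ r n; rewrite r0 r1 => /(_ isT) nr.
have rn0 : 0 <= r ^+ n by exact: exprn_ge0.
have H1 : n.+1%:R * r ^+ n * r ^+ n <= (1 - r)^-1 * r ^+ n by exact: ler_wpM2r.
rewrite !exprS !rS; move: H1; rewrite -addn1 natrD.
have n0 : 0 <= n%:R :> R by [].
have r2 : r * r <= 1 by rewrite mulr_ile1// ltW.
set N := n%:R; set X := r ^+ n * r ^+ n => H1.
have X0 : 0 <= X by rewrite mulr_ge0.
have rX : r * (r * X) <= X by rewrite mulrA ler_piMl.
have rX0 : 0 <= r * (r * X) by rewrite !mulr_ge0.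
have NrX : 0 <= N * (r * (r * X)) by rewrite mulr_ge0.
move: H1; rewrite -[_ / (1 - r) * _]mulrA -[(N + 1) * _ * _]mulrA -/X.
set W := (1 - r)^-1 * _; set Y := r * (r * X) in rX rX0 NrX *.
lra.
Qed.

(** A discrete form of the derivative of x^-q, obtained from
    ln (1 + z) <= z and 1 + z <= exp z. *)
Lemma powRN_gap (R : realType) (x q : R) : 0 < x -> 0 < q ->
  q * (x + 1) `^ (- (q + 1)) <= x `^ (- q) - (x + 1) `^ (- q).
Proof.
move=> x0 q0; have y0 : 0 < x + 1 by lra.
have lnq : q / (x + 1) <= q * (ln (x + 1) - ln x).
  apply: ler_wpM2l; first exact: ltW.
  rewrite -ln_div ?posrE// -lerN2 -lnV ?posrE ?divr_gt0// invf_div.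
  have -> : x / (x + 1) = 1 + - (x + 1)^-1 by field; exact: lt0r_neq0.
  apply: le_ln1Dx; rewrite ltrN2 invf_lt1//; lra.
have xq : x `^ (- q) = (x + 1) `^ (- q) * expR (q * (ln (x + 1) - ln x)).
  by rewrite /powR !gt_eqF// -expRD; congr expR; ring.
have yp : (x + 1) `^ (- (q + 1)) = (x + 1) `^ (- q) / (x + 1).
  rewrite -(powR_inv1 (ltW y0)) -powRD; first by congr (_ `^ _); ring.
  by apply/implyP => _; exact: lt0r_neq0.
rewrite xq yp -[X in _ <= _ - X]mulr1 -mulrBr mulrCA.
apply: ler_wpM2l; first exact: powR_ge0.
rewrite lerBrDl; apply: le_trans (expR_ge1Dx _); rewrite lerD2l//.
Qed.

(** Comparison with a telescoping series, by [powRN_gap]. *)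
Lemma cvg_odd_zeta (R : realType) (p : R) : 1 < p ->
  cvgn (series (fun k => ((1 + 2 * k%:R) `^ p)^-1 : R)).
Proof.
move=> p1; have q0 : 0 < p - 1 by lra.
have pos (k : nat) : 0 < 1 + 2 * k%:R :> R by rewrite ltr_pwDl// mulr_ge0.
apply: nondecreasing_is_cvgn.
  by apply: nondecreasing_series => k _ _; rewrite invr_ge0 powR_ge0.
pose b (k : nat) : R := k.+1%:R `^ (- (p - 1)) / (p - 1).
have b0 k : 0 <= b k by rewrite divr_ge0 ?powR_ge0// ltW.
have step k : ((1 + 2 * k.+1%:R) `^ p)^-1 <= b k - b k.+1.
  have x0 : 0 < k.+1%:R :> R by rewrite ltr0n.
  have kE : k.+1%:R + 1 = k.+2%:R :> R by exact: natr1.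
  rewrite /b -mulrBl ler_pdivlMr// -kE; apply: le_trans (powRN_gap x0 q0).
  rewrite mulrC; apply: ler_wpM2l; first exact: ltW.
  rewrite (_ : - (p - 1 + 1) = - p); last by ring.
  move: (k.+1%:R) x0 => x x0.
  have y0 : 0 < 1 + 2 * x by lra.
  have z0 : 0 < x + 1 by lra.
  rewrite powRN lef_pV2 ?posrE ?powR_gt0//.
  by apply: ge0_ler_powR; rewrite ?nnegrE; lra.
exists (1 + b 0%N) => _ [n _ <-].
have : series (fun k => ((1 + 2 * k%:R) `^ p)^-1 : R) n.+1 <= 1 + b 0%N - b n.
  elim: n => [|n IH].
    by rewrite /series/= big_nat1 mulr0 addr0 powR1 invr1; lra.
  rewrite /series/= big_nat_recr//=; have := step n.
  move: IH; rewrite /series/=; lra.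
have := b0 n; rewrite /series/= big_nat_recr//=.
have : 0 <= ((1 + 2 * n%:R) `^ p)^-1 :> R by rewrite invr_ge0 powR_ge0.
lra.
Qed.

Lemma gamma_s_ge0 (R : realType) (p : R) : 1 < p -> 0 <= gamma_s p.
Proof.
move=> p1; rewrite !mulr_ge0 ?Gamma_ge0//.
apply: limr_ge; first exact: cvg_odd_zeta.
by apply: nearW => n; apply: sumr_ge0 => k _; rewrite invr_ge0 powR_ge0.
Qed.

(** Expand the kernel in a power series and integrate term by term: with
    r = exp (- t), the term r^(2 k) gives the Gamma integral with rate 2 k + 1. *)
Lemma integral_kernel2_le (R : realType) (p : R) : 1 < p ->
  (\int[@lebesgue_measure R]_(r in `]0%R, 1%R[) (kernel2 r * (- ln r) `^ p)%:E <=
   (2 * Gamma (p + 1) * limn (series (fun k => ((1 + 2 * k%:R) `^ p)^-1)))%:E)%E.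
Proof.
move=> p1; have p0 : 0 < p by lra.
pose a (k : nat) : R := 2 * (1 + 2 * k%:R).
have pos (k : nat) : 0 < 1 + 2 * k%:R :> R by rewrite ltr_pwDl// mulr_ge0.
have a0 k : 0 <= a k by rewrite mulr_ge0// ltW.
pose q (k : nat) (t : R) : R := t `^ p * expR (- ((2 * k)%:R) * t).
have q0 k t : 0 <= q k t by rewrite mulr_ge0 ?powR_ge0 ?expR_ge0.
have mq k : measurable_fun setT (q k) by exact: measurable_powR_expR.
have mqln k : measurable_fun setT (fun r : R => q k (- ln r)).
  by apply: measurableT_comp => //; apply: measurable_funN; exact: measurable_ln.
apply: (@le_trans _ _ (\int[@lebesgue_measure R]_(r in `]0%R, 1%R[)
    (\sum_(0 <= k <oo) (a k)%:E * (q k (- ln r))%:E)))%E.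
  apply: ge0_le_integral_nomeas => r; rewrite /= in_itv/= => /andP[r0 r1].
    by rewrite lee_fin mulr_ge0 ?powR_ge0// addr_ge0// invr_ge0 exprn_ge0; lra.
  have r0' := ltW r0.
  rewrite EFinM [leLHS]muleC.
  apply: (@le_trans _ _ (((- ln r) `^ p)%:E *
      \sum_(0 <= k <oo) (a k * r ^+ (2 * k))%:E)%E).
    apply: lee_wpmul2l; first by rewrite lee_fin powR_ge0.
    by apply: kernel2_le_series; rewrite ltW.
  rewrite -nneseriesZl; last by move=> k _; rewrite lee_fin mulr_ge0 ?exprn_ge0.
  apply: lee_nneseries => k.
    by move=> *; rewrite -EFinM lee_fin mulr_ge0 ?powR_ge0// mulr_ge0 ?exprn_ge0.
  move=> _; rewrite -!EFinM lee_fin /q mulrNN expRM_natl lnK//.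
  by rewrite le_eqVlt mulrCA eqxx.
rewrite integral_nneseries//; last 2 first.
- move=> k; apply/measurable_EFinP; apply: measurable_funTS.
  apply: (@measurable_funM _ _ _ _ (cst (a k))); [exact: measurable_cst|exact: mqln].
- by move=> k r _; rewrite -EFinM lee_fin mulr_ge0.
rewrite [in leRHS]EFinM -nneseries_EFin_cvg; last exact: cvg_odd_zeta.
rewrite -nneseriesZl; last by move=> k _; rewrite lee_fin invr_ge0 powR_ge0.
apply: lee_nneseries => k.
  by move=> *; apply: integral_ge0 => r _; rewrite -EFinM lee_fin mulr_ge0.
move=> _; rewrite ge0_integralZl_EFin//; last 2 first.
- by move=> r _; rewrite lee_fin.
- by apply/measurable_EFinP; apply: measurable_funTS; exact: mqln.
rewrite integral_lnN//; last first.
  exact: continuous_powR_expR.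
under eq_integral => t _.
  rewrite /q -mulrA -expRD (_ : - (2 * k)%:R * t - t = - ((1 + 2 * k%:R) * t)); last first.
    by rewrite natrM; ring.
  over.
rewrite integral_powR_expR// -!EFinM lee_fin /a.
rewrite opprD powRD; last by apply/implyP => _; exact: lt0r_neq0.
rewrite (powR_inv1 (ltW (pos k))) powRN le_eqVlt; apply/orP; left; apply/eqP.
by field; rewrite !lt0r_neq0//; exact: powR_gt0.
Qed.

(** * The truncated logarithm *)

Definition clamp (R : realType) (L s : R) : R := Num.min (Num.max s 0) L.

Lemma clamp_ge0 (R : realType) (L s : R) : 0 <= L -> 0 <= clamp L s.
Proof. by move=> L0; rewrite le_min L0 le_max lexx orbT. Qed.

Lemma measurable_clamp (R : realType) (L : R) : measurable_fun setT (clamp L).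
Proof.
by apply: measurable_minr => //; apply: measurable_maxr.
Qed.

Lemma clamp_sub_bounds (R : realType) (L s tau : R) : 0 <= tau ->
  0 <= clamp L (s + tau) - clamp L s <= tau.
Proof.
rewrite /clamp => t0; case: (leP s 0); case: (leP (s + tau) 0) => ? ?;
  try case: (leP 0 L) => ?; try case: (leP s L) => ?;
  try case: (leP (s + tau) L) => ?; lra.
Qed.

(** The increments of clamp are lengths of intervals; this turns g (r y) - g y
    into an integral over the levels t in [0, L], to which Tonelli applies. *)
Lemma clamp_sub_measure (R : realType) (L s tau : R) : 0 <= L -> 0 <= tau ->
  (clamp L (s + tau) - clamp L s)%:E =
  @lebesgue_measure R (`[0, L[ `&` `[s, (s + tau)[).
Proof.
move=> L0 t0.
rewrite (_ : _ `&` _ = `[(Num.max s 0), (Num.min (s + tau) L)[%classic); last first.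
  apply/seteqP; split => x /=; rewrite !in_itv/= ge_max lt_min.
    by move=> [/andP[-> ->] /andP[-> ->]].
  by move=> /andP[/andP[-> ->] /andP[-> ->]].
rewrite lebesgue_measure_itv/= lte_fin /clamp.
case: ifPn; rewrite -?EFinB; [move=> H|rewrite -leNgt => H]; congr EFin; move: H;
  case: (leP s 0) => ?; case: (leP (s + tau) 0) => ?;
  case: (leP (s + tau) L) => ?; try case: (leP 0 L) => ?;
  try case: (leP s L) => ?; lra.
Qed.

(** The Moser function: the logarithmic profile truncated at height L, which it
    reaches at |x| = exp (- L). *)
Definition logclamp (R : realType) (L x : R) : R := clamp L (- ln `|x|).

Lemma measurable_logclamp (R : realType) (L : R) : measurable_fun setT (logclamp L).
Proof.
apply: (measurableT_comp (measurable_clamp L)); apply: measurable_funN.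
apply: (@measurableT_comp _ _ _ _ _ _ (@ln R)); first exact: measurable_ln.
exact: normr_measurable.
Qed.

Lemma logclampN (R : realType) (L x : R) : logclamp L (- x) = logclamp L x.
Proof. by rewrite /logclamp normrN. Qed.

Lemma logclampE (R : realType) (L y : R) : 0 < y -> logclamp L y = clamp L (- ln y).
Proof. by move=> y0; rewrite /logclamp gtr0_norm. Qed.

Lemma logclamp_scale (R : realType) (L r y : R) : 0 < r -> 0 < y ->
  logclamp L (r * y) = clamp L (- ln y + - ln r).
Proof.
move=> r0 y0; rewrite /logclamp gtr0_norm ?mulr_gt0// lnM ?posrE//.
by rewrite opprD addrC.
Qed.

Lemma integral_inv_itv (R : realType) (a b : R) : 0 < a -> a < b ->
  (\int[@lebesgue_measure R]_(y in `[a, b[) (y^-1)%:E = (ln b - ln a)%:E)%E.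
Proof.
move=> a0 ab; rewrite integral_itv_bndo_bndc; last first.
  by apply/measurable_EFinP; apply: measurable_funV.
rewrite (@continuous_FTC2 _ _ (@ln R))//.
- apply: continuous_in_subspaceT => x; rewrite inE/= in_itv/= => /andP[ax _].
  by apply: inv_continuous; rewrite lt0r_neq0// (lt_le_trans a0).
- split.
  + move=> x; rewrite in_itv/= => /andP[ax _].
    by apply: ex_derive; apply: is_derive1_ln; exact: lt_trans ax.
  + by apply: cvg_at_right_filter; apply: continuous_ln.
  + by apply: cvg_at_left_filter; apply: continuous_ln; exact: lt_trans ab.
- move=> x; rewrite in_itv/= => /andP[ax _].
  by rewrite derive1E; apply: derive_val; apply: is_derive1_ln; exact: lt_trans ax.
Qed.

(** For each level t, the y > 0 with g y <= t < g (r y) form the interval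
    [exp (- t), exp (- t) / r[, whose measure for dy / y is - ln r regardless
    of t. *)
Lemma integral_logclamp_diff (R : realType) (L r : R) : 0 <= L -> 0 < r < 1 ->
  (\int[@lebesgue_measure R]_(y in `]0%R, +oo[)
     ((logclamp L (r * y) - logclamp L y) / y)%:E = (L * - ln r)%:E)%E.
Proof.
move=> L0 /andP[r0 r1]; set tau := - ln r.
have tau0 : 0 < tau by rewrite oppr_gt0 ln_lt0// r0.
pose F (z : measurableTypeR R * measurableTypeR R) : \bar R :=
  (if (- ln `|z.1| <= z.2) && (z.2 < - ln `|z.1| + tau) then `|z.1|^-1 else 0)%:E.
have F0 z : (0 <= F z)%E.
  by rewrite lee_fin; case: ifP => // _; rewrite invr_ge0.
have mln : measurable_fun setT
    (fun z : measurableTypeR R * measurableTypeR R => - ln `|z.1|).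
  apply: measurable_funN; apply: (@measurableT_comp _ _ _ _ _ _ (@ln R)).
    exact: measurable_ln.
  by apply: measurableT_comp => //; exact: measurable_fst.
have mF : measurable_fun setT F.
  apply/measurable_EFinP; apply: measurable_fun_ifT => //.
    apply: measurable_and.
      by apply: measurable_fun_ler => //; exact: measurable_snd.
    apply: measurable_fun_ltr; first exact: measurable_snd.
    exact: measurable_funD.
  apply: measurable_funV; apply: measurableT_comp => //; exact: measurable_fst.
transitivity (\int[@lebesgue_measure R]_(y in `]0%R, +oo[)
    \int[@lebesgue_measure R]_(t in `[0%R, L[) F (y, t))%E.
  apply: eq_integral => y; rewrite inE/= in_itv/= andbT => y0.
  rewrite logclamp_scale// logclampE// mulrC EFinM clamp_sub_measure//; last exact: ltW.
  rewrite setIC -integral_indic// -ge0_integralZl_EFin//; last 2 first.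
  - by apply/measurable_EFinP.
  - by rewrite invr_ge0 ltW.
  apply: eq_integral => t _; rewrite -EFinM /F/= gtr0_norm// indicE mem_setE in_itv/=.
  by case: ifP; rewrite ?mulr1 ?mulr0.
rewrite fubini_tonelli_dom//.
transitivity (\int[@lebesgue_measure R]_(t in `[0%R, L[) (cst tau%:E t))%E; last first.
  rewrite integral_cst//= lebesgue_measure_itv/= lte_fin -EFinD subr0.
  move: L0; rewrite le_eqVlt => /predU1P[<-|->]; last by rewrite -EFinM mulrC.
  by rewrite ltxx mule0 mul0r.
apply: eq_integral => t _ /=.
have -> : tau = ln (expR (- t + tau)) - ln (expR (- t)) by rewrite !expRK; ring.
rewrite -integral_inv_itv ?expR_gt0 ?ltr_expR ?ltrDl//.
rewrite [LHS]integral_mkcond [RHS]integral_mkcond.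
apply: eq_integral => y _; rewrite /patch !mem_setE !in_itv/= andbT /F/=.
have [y0|y0] := ltP 0 y; last first.
  by rewrite ifF//; apply/negbTE; rewrite negb_and -ltNge (le_lt_trans y0 (expR_gt0 _)).
rewrite gtr0_norm// -[in RHS](lnK (_ : y \is Num.pos)) ?posrE//.
rewrite ler_expR ltr_expR lnK ?posrE//.
have -> : (- t <= ln y < - t + tau) = (- ln y <= t < - ln y + tau).
  by apply/andP/andP => -[? ?]; split; lra.
by case: ifP.
Qed.

(** The bound does not depend on L: g is at most - ln |x| on ]-1, 1[ and vanishes
    elsewhere. *)
Lemma integral_logclamp_powR_le (R : realType) (p L : R) : 1 < p -> 0 <= L ->
  (\int[@lebesgue_measure R]_x (`|logclamp L x| `^ p)%:E <=
   (2 * Gamma (p + 1))%:E)%E.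
Proof.
move=> p1 L0; have p0 : 0 < p by lra.
have mg : measurable_fun setT (fun x => (`|logclamp L x| `^ p)%:E).
  apply/measurable_EFinP; apply: measurable_fun_powR; apply: measurableT_comp => //.
  exact: measurable_logclamp.
rewrite integral_reflect//.
under eq_integral do rewrite logclampN -EFinD.
have -> : (2 * Gamma (p + 1))%:E = (\int[@lebesgue_measure R]_(r in `]0%R, 1%R[)
    (2 * ((- ln r) `^ p * expR (0 * - ln r)))%:E)%E.
  under eq_integral do rewrite EFinM.
  rewrite ge0_integralZl_EFin//; last 2 first.
  - by move=> r _; rewrite lee_fin mulr_ge0 ?powR_ge0 ?expR_ge0.
  - apply: measurable_funTS; apply/measurable_EFinP.
    apply: (measurableT_comp (measurable_powR_expR p 0)).
    by apply: measurable_funN; exact: measurable_ln.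
  rewrite (integral_lnN (q := fun t => t `^ p * expR (0 * t))).
  - under eq_integral do rewrite mul0r expR0 mulr1.
    by rewrite integral_Gamma.
  - exact: measurable_powR_expR.
  - by move=> t _; rewrite mulr_ge0 ?powR_ge0 ?expR_ge0.
  - exact: continuous_powR_expR.
rewrite [X in (X <= _)%E]integral_mkcond [X in (_ <= X)%E]integral_mkcond.
apply: ge0_le_integral_nomeas => r _.
  by rewrite /patch; case: ifP => // _; rewrite lee_fin addr_ge0 ?powR_ge0.
rewrite /patch !mem_setE !in_itv/= andbT; have [r0/=|//] := ltP 0 r.
have g0 := clamp_ge0 (- ln r) L0.
rewrite logclampE// ger0_norm//; case: ifPn => r1.
  rewrite lee_fin mul0r expR0 mulr1 mulr2n mulrDl !mul1r.
  have t0 : 0 <= - ln r by rewrite oppr_ge0 ln_le0// ltW.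
  have gr : clamp L (- ln r) <= - ln r.
    by rewrite /clamp ge_min ge_max lexx t0.
  by apply: lerD; apply: (ge0_ler_powR _ _ _ gr); rewrite ?nnegrE// ltW.
rewrite (_ : clamp _ _ = 0) ?powR0 ?addr0// ?lt0r_neq0//.
rewrite /clamp (max_r (_ : - ln r <= 0)); last by rewrite oppr_le0 ln_ge0// leNgt.
exact: min_l.
Qed.

(** * The seminorm of the truncated logarithm *)

Lemma measurable_folded_integrand (R : realType) (p : R) (g : R -> R) :
  measurable_fun setT g ->
  measurable_fun setT (fun z : measurableTypeR R * measurableTypeR R =>
    (`|g z.1 - g z.2| `^ p * ((z.1 - z.2) ^- 2 + (z.1 + z.2) ^- 2))%:E).
Proof.
move=> mg; apply/measurable_EFinP; apply: measurable_funM.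
  apply: measurable_fun_powR; apply: measurableT_comp => //.
  by apply: measurable_funB; [exact: measurable_comp_fst|exact: measurable_comp_snd].
apply: measurable_funD; apply: measurable_funV; apply: measurable_funX.
  by apply: measurable_funB; [exact: measurable_fst|exact: measurable_snd].
by apply: measurable_funD; [exact: measurable_fst|exact: measurable_snd].
Qed.

(** Fold both variables onto the half-line; by evenness of g the four quadrants
    give two copies of the kernel |x - y|^-2 and two of |x + y|^-2. *)
Lemma gagliardo_even (R : realType) (p : R) (g : R -> R) : measurable_fun setT g ->
  (forall x, g (- x) = g x) ->
  (\int[@lebesgue_measure R]_y \int[@lebesgue_measure R]_x
     (`|g x - g y| `^ p / `|x - y| ^+ 2)%:E =
   2%:E * \int[@lebesgue_measure R]_(y in `]0%R, +oo[)
     \int[@lebesgue_measure R]_(x in `]0%R, +oo[)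
       (`|g x - g y| `^ p * ((x - y) ^- 2 + (x + y) ^- 2))%:E)%E.
Proof.
move=> mg gN; pose T2 : measurableType _ := (measurableTypeR R * measurableTypeR R)%type.
pose F (z : T2) : \bar R := (`|g z.1 - g z.2| `^ p / `|z.1 - z.2| ^+ 2)%:E.
pose F2 (z : T2) : \bar R :=
  (`|g z.1 - g z.2| `^ p * ((z.1 - z.2) ^- 2 + (z.1 + z.2) ^- 2))%:E.
have F0 z : (0 <= F z)%E by rewrite lee_fin divr_ge0 ?powR_ge0 ?exprn_ge0.
have mF : measurable_fun setT F by exact: measurable_gagliardo_integrand.
have mJ : measurable_fun setT (fun y => \int[@lebesgue_measure R]_x F (x, y))%E.
  exact: measurable_integral_dom.
have mF1 y : measurable_fun setT (fun x : R => F (x, y)).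
  exact: measurableT_comp mF (measurable_pair2 y).
have mF2 : measurable_fun setT F2 by exact: measurable_folded_integrand.
have F20 z : (0 <= F2 z)%E.
  by rewrite lee_fin mulr_ge0 ?powR_ge0// addr_ge0// invr_ge0 exprn_even_ge0.
have F2E (x y : R) : (F (x, y) + F ((- x)%R, y) = F2 (x, y))%E.
  rewrite /F/F2/= gN -EFinD -mulrDr !real_normK ?num_real//.
  by congr (_ * (_ + _^-1))%:E; rewrite -opprD sqrrN.
have F2N (x y : R) : (F (x, (- y)%R) + F ((- x)%R, (- y)%R) = F2 (x, y))%E.
  rewrite /F/F2/= !gN -EFinD -mulrDr !real_normK ?num_real// opprK.
  congr (_ * _)%:E; rewrite [LHS]addrC; congr (_^-1 + _).
  by rewrite -sqrrN; congr (_ ^+ 2); ring.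
rewrite [LHS](@integral_reflect _
  (fun y => \int[@lebesgue_measure R]_x F (x, y))%E)//; last first.
  by move=> y; exact: integral_ge0.
transitivity (\int[@lebesgue_measure R]_(y in `]0%R, +oo[) (2%:E *
    \int[@lebesgue_measure R]_(x in `]0%R, +oo[) F2 (x, y)))%E; last first.
  rewrite ge0_integralZl_EFin//.
  - by move=> y _; exact: integral_ge0.
  - by apply: measurable_funTS; exact: measurable_integral_dom.
apply: eq_integral => y _.
rewrite !integral_reflect//.
under eq_integral do rewrite F2E.
under [X in (_ + X)%E]eq_integral do rewrite F2N.
by rewrite -mule2n mule_natl.
Qed.

(** One factor of |g (r y) - g y|^p is kept for the integration in y, and the
    p - 1 others are bounded by - ln r.  The kernel is homogeneous of degree -2,
    so that only dy / y remains. *)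
Lemma logclamp_scaled_bound (R : realType) (p L r y : R) : 1 < p -> 0 < r < 1 ->
  0 < y ->
  y * (`|logclamp L (y * r) - logclamp L y| `^ p *
       ((y * r - y) ^- 2 + (y * r + y) ^- 2)) <=
  kernel2 r * (- ln r) `^ (p - 1) * (`|logclamp L (r * y) - logclamp L y| / `|y|).
Proof.
move=> p1 /andP[r0 r1] y0; rewrite [y * r]mulrC (gtr0_norm y0).
have tau0 : 0 < - ln r by rewrite oppr_gt0 ln_lt0// r0.
have := @clamp_sub_bounds _ L (- ln y) _ (ltW tau0).
rewrite -logclamp_scale// -logclampE// => /andP[d0 dt].
rewrite (ger0_norm d0); set d := logclamp L (r * y) - logclamp L y in d0 dt *.
have -> : (r * y - y) ^- 2 + (r * y + y) ^- 2 = kernel2 r / y ^+ 2.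
  have -> : r * y - y = - ((1 - r) * y) by ring.
  have -> : r * y + y = (1 + r) * y by ring.
  by rewrite sqrrN /kernel2 -!exprVn !invfM !exprMn -mulrDl.
have -> : y * (d `^ p * (kernel2 r / y ^+ 2)) = kernel2 r * d `^ p / y.
  by field; exact: lt0r_neq0.
rewrite mulrA ler_wpM2r ?invr_ge0 ?(ltW y0)// -mulrA ler_wpM2l ?kernel2_ge0//.
rewrite -mulr_powRB1//; last lra.
rewrite [leRHS]mulrC ler_wpM2l//.
apply: ge0_ler_powR; rewrite ?nnegrE//; [lra|exact: ltW].
Qed.

(** Folding gives a factor 2, symmetry another one; the substitution x = y r and
    Tonelli reduce the rest to L times [integral_kernel2_le], which brings the
    last factor 2 of gamma_s = 8 Gamma (p + 1) sum_k (2 k + 1)^-p. *)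
Lemma gagliardo_logclamp_le (R : realType) (p L : R) : 1 < p -> 0 <= L ->
  (\int[@lebesgue_measure R]_y \int[@lebesgue_measure R]_x
     (`|logclamp L x - logclamp L y| `^ p / `|x - y| ^+ 2)%:E <=
   (gamma_s p * L)%:E)%E.
Proof.
move=> p1 L0; set g := logclamp L.
have mg : measurable_fun setT g by exact: measurable_logclamp.
have two0 : (0 <= 2%:E :> \bar R)%E by rewrite lee_fin.
rewrite gagliardo_even//; last exact: logclampN.
pose T2 : measurableType _ := (measurableTypeR R * measurableTypeR R)%type.
pose F2 (z : T2) : \bar R :=
  (`|g z.1 - g z.2| `^ p * ((z.1 - z.2) ^- 2 + (z.1 + z.2) ^- 2))%:E.
have F20 z : (0 <= F2 z)%E.
  by rewrite lee_fin mulr_ge0 ?powR_ge0// addr_ge0// invr_ge0 exprn_even_ge0.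
have mF2 : measurable_fun setT F2 by exact: measurable_folded_integrand.
pose D : set (measurableTypeR R) := `]0, +oo[%classic.
have mD : measurable D by exact: measurable_itv.
rewrite (@integral_symmetric _ F2 D mD mF2 F20); last 2 first.
- by move=> x y; rewrite /F2/= distrC -sqrrN opprB [y + x]addrC.
- by move=> x; rewrite /F2/= subrr normr0 powR0 ?mul0r// lt0r_neq0//; lra.
pose W (r : R) : R := if r < 1 then kernel2 r * (- ln r) `^ (p - 1) else 0.
have W0 r : 0 <= W r.
  by rewrite /W; case: ifP => // _; rewrite mulr_ge0 ?powR_ge0 ?kernel2_ge0.
have mW : measurable_fun setT W.
  apply: measurable_fun_ifT => //; first exact: measurable_fun_ltr.
  apply: measurable_funM.
    apply: measurable_funD; apply: measurable_funV; apply: measurable_funX.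
      exact: measurable_funB.
    exact: measurable_funD.
  apply: measurable_fun_powR; apply: measurable_funN; exact: measurable_ln.
(* The majorant of the integrand after x = y r, in the variables z = (y, r). *)
pose H (z : T2) : \bar R :=
  (W z.2 * (`|g (z.2 * z.1) - g z.1| / `|z.1|))%:E.
have H0 z : (0 <= H z)%E by rewrite lee_fin mulr_ge0// divr_ge0.
have mH : measurable_fun setT H.
  apply/measurable_EFinP; apply: measurable_funM; first exact: measurable_comp_snd.
  apply: measurable_funM; last first.
    apply: measurable_funV; apply: measurableT_comp => //; exact: measurable_fst.
  apply: measurableT_comp => //; apply: measurable_funB; last exact: measurable_comp_fst.
  apply: measurableT_comp => //.
  by apply: measurable_funM; [exact: measurable_snd|exact: measurable_fst].
apply: (@le_trans _ _ (2%:E * (2%:E * \int[@lebesgue_measure R]_(y in D)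
    \int[@lebesgue_measure R]_(r in D) H (y, r)))%E).
  apply: (lee_wpmul2l two0); apply: (lee_wpmul2l two0).
  apply: ge0_le_integral_nomeas => y; rewrite /D/= in_itv/= andbT => y0.
    by apply: integral_ge0 => x _; case: ifP.
  rewrite (ge0_integral_scale_y y0); last 2 first.
  - apply: measurable_fun_ifT => //; first exact: measurable_fun_ltr.
    exact: measurableT_comp mF2 (measurable_pair2 y).
  - by move=> x _; case: ifP.
  rewrite -ge0_integralZl_EFin//; last 3 first.
  - by move=> x _; case: ifP.
  - apply: measurable_funTS; apply: measurable_fun_ifT => //.
      by apply: measurable_fun_ltr => //; exact: measurable_funM.
    apply: (@measurableT_comp _ _ _ _ _ _ (fun x => F2 (x, y)) _ (fun r => y * r)).
      exact: measurableT_comp mF2 (measurable_pair2 y).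
    exact: measurable_funM.
  - exact: ltW.
  apply: ge0_le_integral_nomeas => r; rewrite /= in_itv/= andbT => r0.
    by rewrite mule_ge0 ?lee_fin ?(ltW y0)//; case: ifP.
  rewrite -[X in (_ * r < X)%R]mulr1 ltr_pM2l// /H /W /=.
  case: ifPn => r1; last by rewrite mule0 mul0r.
  by rewrite -EFinM lee_fin /g logclamp_scaled_bound// r0.
rewrite fubini_tonelli_dom//.
apply: (@le_trans _ _ (2%:E * (2%:E * (L%:E * \int[@lebesgue_measure R]_(r in `]0%R, 1%R[)
   (kernel2 r * (- ln r) `^ p)%:E)))%E); last first.
  have L0' : (0 <= L%:E)%E by rewrite lee_fin.
  have := lee_wpmul2l two0 (lee_wpmul2l two0 (lee_wpmul2l L0' (integral_kernel2_le p1))).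
  move=> /le_trans; apply; rewrite -!EFinM.
  by rewrite lee_fin le_eqVlt /gamma_s; apply/orP; left; apply/eqP; ring.
apply: (lee_wpmul2l two0); apply: (lee_wpmul2l two0).
rewrite -ge0_integralZl_EFin//; last 2 first.
- by move=> r _; rewrite lee_fin mulr_ge0 ?powR_ge0 ?kernel2_ge0.
- apply: measurable_funTS; apply/measurable_EFinP; apply: measurable_funM.
    apply: measurable_funD; apply: measurable_funV; apply: measurable_funX.
      exact: measurable_funB.
    exact: measurable_funD.
  apply: measurable_fun_powR; apply: measurable_funN; exact: measurable_ln.
rewrite [X in (X <= _)%E]integral_mkcond [X in (_ <= X)%E]integral_mkcond.
apply: ge0_le_integral_nomeas => r _.
  by rewrite /patch; case: ifP => // _; apply: integral_ge0.
rewrite /patch /D !mem_setE !in_itv/= andbT.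
have [r0/=|//] := ltP 0 r.
rewrite /H/= /W; case: ifPn => r1; last first.
  by rewrite integral0_eq// => y _; rewrite mul0r.
rewrite (_ : integral _ _ _ = (\int[@lebesgue_measure R]_(y in `]0%R, +oo[)
   ((kernel2 r * (- ln r) `^ (p - 1))%:E * ((g (r * y) - g y) / y)%:E))%E); last first.
  apply: eq_integral => y; rewrite inE/= in_itv/= andbT => y0.
  rewrite -EFinM (gtr0_norm y0) ger0_norm// /g logclamp_scale// logclampE//.
  have t0 : 0 <= - ln r by rewrite oppr_ge0 ln_le0// ltW.
  by have /andP[] := @clamp_sub_bounds _ L (- ln y) _ t0.
rewrite ge0_integralZl_EFin//; last 3 first.
- move=> y /=; rewrite in_itv/= andbT => y0; rewrite lee_fin divr_ge0 ?(ltW y0)//.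
  have t0 : 0 <= - ln r by rewrite oppr_ge0 ln_le0// ltW.
  rewrite /g logclamp_scale// logclampE//.
  by have /andP[] := @clamp_sub_bounds _ L (- ln y) _ t0.
- apply: measurable_funTS; apply/measurable_EFinP; apply: measurable_funM.
    by apply: measurable_funB => //; apply: measurableT_comp.
  exact: (@measurable_funV _ _ _ _ id).
- by rewrite mulr_ge0 ?powR_ge0 ?kernel2_ge0.
rewrite integral_logclamp_diff ?r0// -!EFinM lee_fin.
rewrite -(@mulr_powRB1 _ (- ln r) p); [|by rewrite oppr_ge0 ln_le0// ltW|lra].
by rewrite le_eqVlt; apply/orP; left; apply/eqP; ring.
Qed.

(** * Blow-up of the supremum for large exponents *)

Lemma Wsp_scaled_logclamp (R : realType) (p L c : R) : 1 < p -> 0 <= L -> 0 <= c ->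
  c `^ p * (2 * Gamma (p + 1) + gamma_s p * L) <= 1 ->
  Wsp p (fun x => c * logclamp L x) /\
  (Wsp_norm p (fun x => c * logclamp L x)%R <= 1)%E.
Proof.
move=> p1 L0 c0 cp1; have p0 : 0 < p by lra.
set u := fun x => c * logclamp L x.
have mesu : measurable_fun setT u.
  by apply: measurable_funM => //; exact: measurable_logclamp.
have cp0 : 0 <= c `^ p by exact: powR_ge0.
have Np : (\int[@lebesgue_measure R]_x (`|u x| `^ p)%:E <=
    (c `^ p * (2 * Gamma (p + 1)))%:E)%E.
  rewrite EFinM.
  apply: le_trans (lee_wpmul2l _ (integral_logclamp_powR_le p1 L0)); last by rewrite lee_fin.
  rewrite -ge0_integralZl_EFin//; last first.
    apply/measurable_EFinP; apply: measurable_fun_powR; apply: measurableT_comp => //.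
    exact: measurable_logclamp.
  rewrite le_eqVlt; apply/orP; left; apply/eqP; apply: eq_integral => x _.
  by rewrite -EFinM /u normrM powRM// (ger0_norm c0).
have Gp : (\int[@lebesgue_measure R]_y \int[@lebesgue_measure R]_x
    (`|u x - u y| `^ p / `|x - y| ^+ 2)%:E <= (c `^ p * (gamma_s p * L))%:E)%E.
  rewrite EFinM.
  apply: le_trans (lee_wpmul2l _ (gagliardo_logclamp_le p1 L0)); last by rewrite lee_fin.
  pose F (z : measurableTypeR R * measurableTypeR R) : \bar R :=
    (`|logclamp L z.1 - logclamp L z.2| `^ p / `|z.1 - z.2| ^+ 2)%:E.
  have F0 z : (0 <= F z)%E by rewrite lee_fin divr_ge0 ?powR_ge0 ?exprn_ge0.
  have mF : measurable_fun setT F.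
    by apply: measurable_gagliardo_integrand; exact: measurable_logclamp.
  rewrite -ge0_integralZl_EFin//; last 2 first.
  - by move=> y _; apply: integral_ge0 => x _; exact: (F0 (x, y)).
  - exact: (measurable_integral_dom measurableT mF F0).
  rewrite le_eqVlt; apply/orP; left; apply/eqP; apply: eq_integral => y _.
  rewrite -ge0_integralZl_EFin//; last first.
    exact: measurableT_comp mF (measurable_pair2 y).
  apply: eq_integral => x _.
  by rewrite -EFinM /u -mulrBr normrM powRM// (ger0_norm c0) mulrA.
have N1 : (Wsp_norm p u <= 1)%E.
  rewrite Wsp_norm_le1//; apply: (le_trans (leeD Np Gp)).
  by rewrite -EFinD lee_fin -mulrDr.
split=> //; split.
  rewrite inE; apply/andP; split; rewrite inE//; apply/asboolP.
  apply/asboolP; rewrite /= /finite_norm; apply: (lty_poweRy (lt0r_neq0 p0)).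
  rewrite poweR_Lnorm_EFin ?lt0r_neq0//.
  by apply: le_lt_trans Np _; rewrite ltry.
by apply: poweR_lty; apply: le_lt_trans Gp _; rewrite ltry.
Qed.

(** Integrate over ]0, exp (- L)[ only, where the test function is equal to
    c L. *)
Lemma MT_sup_ge_logclamp (R : realType) (s p alpha L c : R) : s < 1 -> 1 < p ->
  0 <= L -> 0 <= c -> 0 <= alpha ->
  c `^ p * (2 * Gamma (p + 1) + gamma_s p * L) <= 1 ->
  ((Phi p (alpha * (c * L) `^ (1 - s)^-1) * expR (- L))%:E <= MT_sup s p alpha)%E.
Proof.
move=> s1 p1 L0 c0 a0 cp1; set A := Phi p _.
have t0 x : 0 <= alpha * x `^ (1 - s)^-1 by rewrite mulr_ge0 ?powR_ge0.
have A0 : 0 <= A by apply: Phi_ge0.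
have [uW uN] := Wsp_scaled_logclamp p1 L0 c0 cp1.
set u := fun x => c * logclamp L x in uW uN.
apply: (@le_trans _ _ (\int[@lebesgue_measure R]_x
    (Phi p (alpha * `|u x| `^ (1 - s)^-1))%:E)%E); last first.
  by apply: ereal_sup_ubound; exists u.
have mI : measurable (`]0, (expR (- L))[%classic : set R) by exact: measurable_itv.
have -> : ((A * expR (- L))%:E = A%:E * @lebesgue_measure R `]0%R, (expR (- L))%R[)%E.
  by rewrite lebesgue_measure_itv/= lte_fin expR_gt0 -EFinB subr0 EFinM.
rewrite -(@ge0_integral_cst_indic _ _ _ (@lebesgue_measure R) _ _ A0 mI).
apply: ge0_le_integral_nomeas => x _; first by rewrite lee_fin mulr_ge0.
rewrite lee_fin indicE; case: (boolP (x \in _)) => [|_]; last by rewrite mulr0 Phi_ge0.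
rewrite inE/= in_itv/= mulr1 => /andP[x0 xL].
have lnx : L < - ln x by rewrite ltrNr -(expRK (- L)) ltr_ln// posrE expR_gt0.
have -> : u x = c * L.
  rewrite /u logclampE// /clamp max_l; last by rewrite (le_trans L0)// ltW.
  by rewrite min_r// ltW.
by rewrite ger0_norm// mulr_ge0.
Qed.

(** Choose rho' strictly between gamma_s and rho = alpha^((1 - s) / s).  For L
    large, 2 Gamma (p + 1) + gamma_s L <= rho' L, so c = (rho' L)^(-s) is an
    admissible scaling.  As (c L)^(1 / (1 - s)) = rho'^(- s / (1 - s)) L, the
    argument of Phi is exactly kappa L with kappa = (rho / rho')^(s / (1 - s)) > 1. *)
Lemma MT_sup_pinfty (R : realType) (s p alpha : R) : 0 < s -> s < 1 -> 1 < p ->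
  s * p = 1 -> alpha_star s p < alpha -> MT_sup s p alpha = +oo%E.
Proof.
move=> s0 s1 p1 sp aa; have p0 : 0 < p by lra.
have g0 := gamma_s_ge0 p1; set g := gamma_s p in g0.
pose th := s / (1 - s); have th0 : 0 < th by rewrite divr_gt0//; lra.
have a0 : 0 < alpha by apply: le_lt_trans aa; exact: powR_ge0.
pose rho := alpha `^ th^-1.
have rho_g : g < rho.
  have := gt0_ltr_powR (_ : 0 < th^-1) (_ : g `^ th \in Num.nneg) (_ : alpha \in Num.nneg) aa.
  rewrite -powRrM divff ?lt0r_neq0// powRr1// => ->//; rewrite ?invr_gt0//.
    by rewrite nnegrE powR_ge0.
  by rewrite nnegrE ltW.
have rhoth : rho `^ th = alpha by rewrite -powRrM mulVf ?lt0r_neq0// powRr1// ltW.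
pose rho' := (g + rho) / 2.
have rho'0 : 0 < rho' by rewrite /rho'; lra.
pose kappa := (rho / rho') `^ th.
have k1 : 1 < kappa.
  have r1 : 1 < rho / rho' by rewrite ltr_pdivlMr// /rho'; lra.
  have := gt0_ltr_powR th0 (_ : 1 \in Num.nneg) (_ : rho / rho' \in Num.nneg) r1.
  by rewrite powR1; apply; rewrite nnegrE//; lra.
apply/eqyP => B B0; set K := kappa ^+ `|Num.ceil (p - 2)|%N.+1.
pose A := 2 * Gamma (p + 1).
have rg : 0 < rho' - g by rewrite /rho'; lra.
have k1' : 0 < kappa - 1 by lra.
pose L := Num.max 1 (Num.max (A / (rho' - g)) ((B + K) / (kappa - 1))).
have L1 : 1 <= L by rewrite le_max lexx.
have AL : A <= L * (rho' - g) by rewrite -ler_pdivrMr// !le_max lexx orbT.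
have BL : B + K <= L * (kappa - 1) by rewrite -ler_pdivrMr// !le_max lexx !orbT.
have L0 : 0 < L by lra.
have rL0 : 0 < rho' * L by rewrite mulr_gt0.
pose c := (rho' * L) `^ (- s).
have c0 : 0 <= c by exact: powR_ge0.
have cpE : c `^ p = (rho' * L)^-1 by rewrite -powRrM mulNr sp powR_inv1// ltW.
have cp1 : c `^ p * (2 * Gamma (p + 1) + gamma_s p * L) <= 1.
  rewrite cpE mulrC ler_pdivrMr// mul1r -/A -/g -lerBrDr.
  by apply: le_trans AL _; rewrite mulrBr [L * rho']mulrC [L * g]mulrC.
have s1' : 1 - s != 0 by rewrite subr_eq0 gt_eqF.
have tE : alpha * (c * L) `^ (1 - s)^-1 = kappa * L.
  have -> : c * L = rho' `^ (- s) * L `^ (1 - s).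
    rewrite /c powRM ?(ltW rho'0) ?(ltW L0)// -mulrA; congr (_ * _).
    rewrite mulrC -[X in X * _]powRr1 ?(ltW L0)// -powRD//.
    by apply/implyP => _; exact: lt0r_neq0.
  rewrite powRM ?powR_ge0// -!powRrM mulfV// powRr1 ?(ltW L0)// mulrA; congr (_ * _).
  rewrite mulNr powRN -rhoth -/th /kappa -powR_inv1 ?powR_ge0//.
  by rewrite powRM ?powR_ge0 ?invr_ge0 ?(ltW rho'0)// -(powR_inv1 (ltW rho'0)) powRAC.
apply: le_trans (MT_sup_ge_logclamp s1 p1 (ltW L0) c0 (ltW a0) cp1).
rewrite tE lee_fin; apply: le_trans (le_Phi_expRN p k1 (ltW L0) (lexx _)).
by rewrite lerBrDr (le_trans BL)// mulrC lerDr.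
Qed.

Theorem theorem1p2 (R : realType) (s p : R) (hs0 : 0 < s) (hs1 : s < 1)
  (hp : 1 < p) (hsp : s * p = 1) :
  (exists alpha_low : R, 0 < alpha_low /\
     forall alpha : R, 0 <= alpha < alpha_low ->
       (MT_sup s p alpha < +oo)%E)
  /\
  (forall alpha : R, alpha_star s p < alpha -> MT_sup s p alpha = +oo%E).
Proof.
split; last by move=> alpha; exact: MT_sup_pinfty.
have five : 0 < 5 `^ (1 - s)^-1 :> R by rewrite powR_gt0.
exists (ln 2 / 5 `^ (1 - s)^-1); split.
  by rewrite divr_gt0// ln_gt0// ltr1n.
move=> alpha /andP[a0 alt]; apply: MT_sup_lty => //.
by rewrite -ltr_pdivlMr.
Qed.
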